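(* Let $u_0\in H^4(\mathbb{R})$ be non-trivial (not identically zero). Then there exists a strip $\mathcal{S}\subseteq\mathbb{R}^2$, uniquely determined by $u_0$, such that: (a) the one-forms $\omega_1,\omega_2,\omega_3$ below are defined on $\mathcal{S}$, where $u$ is the unique solution of the Cauchy problem $$u_t+uu_x=-\partial_x(1-\partial_x^2)^{-1}\Big(\tfrac32u^2\Big),\qquad u(x,0)=u_0(x);$$ (b) there exists at least one (nonempty) simply connected set $\mathcal{C}\subseteq\mathcal{S}$ such that $\omega_1\wedge\omega_2|_p\neq0$ for every $p\in\mathcal{C}$. As a result, $\mathcal{C}$ has the structure of a $C^1$ pseudospherical surface (Gaussian curvature $-1$) modelled by a function space $\mathcal{B}\subseteq C^{3,1}(\mathbb{R}\times[0,T))$, where $T>0$ is determined by $u_0$.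
   Context: $H^s(\mathbb{R})$ is the $L^2$-based Sobolev space. $(1-\partial_x^2)^{-1}f=G\ast f$ with $G(x)=\tfrac12e^{-|x|}$. For $u_0\in H^4(\mathbb{R})$ the Cauchy problem has a unique solution $u\in C^0([0,T);H^4(\mathbb{R}))\cap C^1([0,T);H^3(\mathbb{R}))$ with maximal time $T=T(u_0)>0$. $C^{3,1}(\mathbb{R}\times[0,T))$ denotes functions $u$ with $\partial_x^iu$ ($0\le i\le3$) and $\partial_x^j\partial_tu$ ($0\le j\le2$) continuous. With $m=u-u_{xx}$, $F=u_x^2-2uu_x+uu_{xx}$, a real parameter $\mu$ and a fixed sign choice (upper signs together or lower signs together): $\omega_1=m\,dx+F\,dt$, $\omega_2=(\mu m\pm2\sqrt{1+\mu^2})dx+\mu F\,dt$, $\omega_3=(\pm\sqrt{1+\mu^2}\,m+2\mu)dx\pm\sqrt{1+\mu^2}\,F\,dt$. A pseudospherical surface structure on a region means one-forms $\omega_1,\omega_2,\omega_3$ there with $d\omega_1=\omega_3\wedge\omega_2$, $d\omega_2=\omega_1\wedge\omega_3$, $d\omega_3=\omega_1\wedge\omega_2$ and $\omega_1\wedge\omega_2\neq0$, giving the metric $\omega_1^2+\omega_2^2$ of curvature $-1$. *)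

(* Defs.v *)
From HB Require Import structures.
From mathcomp Require Import all_boot all_order all_algebra.
From mathcomp Require Import all_classical all_reals all_analysis.
Set Implicit Arguments. Unset Strict Implicit. Unset Printing Implicit Defensive.
Import Order.TTheory GRing.Theory Num.Theory.
Import numFieldNormedType.Exports.
Local Open Scope classical_set_scope.
Local Open Scope ring_scope.

Section Defs.
Variable R : realType.
Notation mu := (@lebesgue_measure R).

Definition L2 (f : R -> R) : Prop :=
  measurable_fun setT f /\ mu.-integrable setT (fun x => ((f x) ^+ 2)%:E).

Definition test_fun (phi : R -> R) : Prop :=
  (forall n x, derivable (derive1n n phi) x 1) /\
  exists M : R, forall x, M < `|x| -> phi x = 0.

Definition weak_deriv (k : nat) (f g : R -> R) : Prop :=
  forall phi, test_fun phi ->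
    Rintegral mu setT (fun x => f x * derive1n k phi x)
    = (-1) ^+ k * Rintegral mu setT (fun x => g x * phi x).

Definition sobolev_derivs (k : nat) (f : R -> R) (D : nat -> R -> R) : Prop :=
  D 0%N = f /\ forall j, (j <= k)%N -> L2 (D j) /\ weak_deriv j f (D j).

Definition H (k : nat) (f : R -> R) : Prop := exists D, sobolev_derivs k f D.

Definition tI (T : \bar R) : set R := [set t | 0 <= t /\ (t%:E < T)%E].

(* ---------- solution class C^0([0,T);H^4) cap C^1([0,T);H^3) ----------
   u x t is the value at (x,t).  D j t = j-th weak x-derivative of u(.,t);
   V j t = j-th weak x-derivative of the time derivative u_t(t) in H^3. *)
Definition sq_dist (f g : R -> R) : R :=
  Rintegral mu setT (fun x => (f x - g x) ^+ 2).

Definition nonlocal (u : R -> R -> R) (t x : R) : R :=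
  Rintegral mu setT
    (fun y => (2^-1 * expR (- `|x - y|)) * (3 / 2 * (u y t) ^+ 2)).

Definition is_solution (u0 : R -> R) (T : \bar R) (u : R -> R -> R) : Prop :=
  (0 < T)%E /\
  exists (D V : nat -> R -> R -> R),
    (forall t, tI T t -> sobolev_derivs 4 (fun x => u x t) (D ^~ t)) /\
    (forall t, tI T t -> sobolev_derivs 3 (V 0%N t) (V ^~ t)) /\
    (forall j t0, (j <= 4)%N -> tI T t0 ->
       (fun t => sq_dist (D j t) (D j t0)) @ within (tI T) (nbhs t0) --> (0 : R)) /\
    (forall j t0, (j <= 3)%N -> tI T t0 ->
       (fun t => sq_dist (V j t) (V j t0)) @ within (tI T) (nbhs t0) --> (0 : R)) /\
    (forall j t0, (j <= 3)%N -> tI T t0 ->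
       (fun t => sq_dist (fun x => (t - t0)^-1 * (D j t x - D j t0 x)) (V j t0))
         @ within [set t | tI T t /\ t != t0] (nbhs t0) --> (0 : R)) /\
    (* the equation u_t + u u_x = - d/dx (1 - d_x^2)^{-1} (3/2 u^2) *)
    (forall t, tI T t ->
       {ae mu, forall x, V 0%N t x + u x t * D 1%N t x
                        = - derive1 (nonlocal u t) x}) /\
    {ae mu, forall x, u x 0 = u0 x}.

Definition maximal_time (u0 : R -> R) (T : \bar R) : Prop :=
  forall (T' : \bar R) (u' : R -> R -> R), (T < T')%E -> ~ is_solution u0 T' u'.

Definition dxn (n : nat) (f : R -> R -> R) (x t : R) : R :=
  derive1n n (fun y => f y t) x.

Definition strip (T : \bar R) : set (R * R) := [set p | tI T p.2].

Definition is_tderiv (T : \bar R) (f : R -> R -> R) (x t l : R) : Prop :=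
  (fun h => h^-1 * (f x (t + h) - f x t))
    @ within [set h | tI T (t + h) /\ h != 0] (nbhs (0 : R)) --> l.

Definition C31 (T : \bar R) (u : R -> R -> R) : Prop :=
  exists ut : R -> R -> R,
    (forall x t, tI T t -> is_tderiv T u x t (ut x t)) /\
    (forall x t i, tI T t -> (i < 3)%N -> derivable (dxn i u ^~ t) x 1) /\
    (forall x t j, tI T t -> (j < 2)%N -> derivable (dxn j ut ^~ t) x 1) /\
    (forall i, (i <= 3)%N ->
       {within strip T, continuous (fun p : R * R => dxn i u p.1 p.2)}) /\
    (forall j, (j <= 2)%N ->
       {within strip T, continuous (fun p : R * R => dxn j ut p.1 p.2)}).

Record oneform := OneForm { cdx : R -> R -> R ; cdt : R -> R -> R }.

(* w /\ v = (wedge w v) dx /\ dt *)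
Definition wedge (w v : oneform) (p : R * R) : R :=
  cdx w p.1 p.2 * cdt v p.1 p.2 - cdt w p.1 p.2 * cdx v p.1 p.2.

Definition dform_ex (w : oneform) (p : R * R) : Prop :=
  derivable (fun y => cdt w y p.2) p.1 1 /\ derivable (fun s => cdx w p.1 s) p.2 1.

(* d w = (dform w) dx /\ dt *)
Definition dform (w : oneform) (p : R * R) : R :=
  derive1 (fun y => cdt w y p.2) p.1 - derive1 (fun s => cdx w p.1 s) p.2.

Definition pss_structure (C : set (R * R)) (w1 w2 w3 : oneform) : Prop :=
  forall p, C p ->
    [/\ dform_ex w1 p, dform_ex w2 p & dform_ex w3 p] /\
    [/\ dform w1 p = wedge w3 w2 p, dform w2 p = wedge w1 w3 p,
        dform w3 p = wedge w1 w2 p & wedge w1 w2 p != 0].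

Definition m_of (u : R -> R -> R) : R -> R -> R :=
  fun x t => u x t - dxn 2 u x t.
Definition F_of (u : R -> R -> R) : R -> R -> R :=
  fun x t => (dxn 1 u x t) ^+ 2 - 2 * u x t * dxn 1 u x t + u x t * dxn 2 u x t.
Definition sgn (sg : bool) : R := if sg then 1 else -1.

Definition omega1 (u : R -> R -> R) : oneform := OneForm (m_of u) (F_of u).
Definition omega2 (mu0 : R) (sg : bool) (u : R -> R -> R) : oneform :=
  OneForm (fun x t => mu0 * m_of u x t + sgn sg * 2 * Num.sqrt (1 + mu0 ^+ 2))
          (fun x t => mu0 * F_of u x t).
Definition omega3 (mu0 : R) (sg : bool) (u : R -> R -> R) : oneform :=
  OneForm (fun x t => sgn sg * Num.sqrt (1 + mu0 ^+ 2) * m_of u x t + 2 * mu0)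
          (fun x t => sgn sg * Num.sqrt (1 + mu0 ^+ 2) * F_of u x t).

Definition unit_sq : set (R * R) := [set p | p.1 \in `[0, 1] /\ p.2 \in `[0, 1]].

Definition simply_connected (C : set (R * R)) : Prop :=
  (forall p q, C p -> C q -> exists g : R -> R * R,
     [/\ {within `[0, 1], continuous g}, g 0 = p, g 1 = q & g @` `[0, 1] `<=` C]) /\
  (forall g : R -> R * R,
     {within `[0, 1], continuous g} -> g 0 = g 1 -> g @` `[0, 1] `<=` C ->
     exists Hh : R * R -> R * R,
       [/\ {within unit_sq, continuous Hh},
           (forall s, s \in `[0, 1] -> Hh (s, 0) = g s /\ Hh (s, 1) = g 0),
           (forall r, r \in `[0, 1] -> Hh (0, r) = g 0 /\ Hh (1, r) = g 0)
         & Hh @` unit_sq `<=` C]).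

End Defs.

(* Main.v *)
(** An [H^k] function has a representative which is absolutely continuous with its
    first [k-1] weak derivatives: testing the weak derivative against
    [S((x-a)/e) - S((x-b)/e)], with [S] a smooth step and [a], [b] Lebesgue points, and
    letting [e] tend to 0 gives [f b - f a = \int_a^b f'].  Together with the Sobolev bound
    [|h|_oo <= d + (|h|_2^2 + |h'|_2^2) / (2 d)] applied to differences and difference
    quotients in time, this turns [C^0 H^4 /\ C^1 H^3] into [C^{3,1}], and makes
    [m = u - u_xx] differentiable in time.

    As [p = G * w] satisfies [p - p'' = w], the nonlocal equation becomes
    [m_t = -4 u u_x + 3 u_x u_xx + u u_xxx], that is [m_t = F_x + 2 F], which is equivalent
    to each of the three structure equations.  Moreover [omega1 /\ omega2] is a nonzero
    multiple of [F].

    If [F] vanished for all [t > 0], then [(u u_x e^{-2x})_x = F e^{-2x} = 0], so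
    [u u_x = c e^{2x}]; boundedness forces [c = 0], hence [u^2] is constant, hence 0 by
    integrability, and [u0 = 0] by continuity in time.  So [F <> 0] at some point with
    [t > 0], and on a small ball around it. *)

Require Import Defs.
From HB Require Import structures.
From mathcomp Require Import all_boot all_order all_algebra.
From mathcomp Require Import all_classical all_reals all_analysis.
From mathcomp Require Import measurable_realfun ring lra.
Set Implicit Arguments.
Unset Strict Implicit.
Unset Printing Implicit Defensive.
Import Order.TTheory GRing.Theory Num.Theory.
Import numFieldNormedType.Exports.
Local Open Scope classical_set_scope.
Local Open Scope ring_scope.

(** * Derivatives and a smooth step *)

Lemma is_derive1_derive1 (R : realType) (f : R -> R) (x a : R) :
  is_derive x 1 f a -> derive1 f x = a.
Proof. by move=> h; rewrite derive1E derive_val. Qed.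

Lemma is_derive_continuous (R : realType) (f : R -> R) (x a : R) :
  is_derive x 1 f a -> {for x, continuous f}.
Proof.
by move=> [h _]; apply/differentiable_continuous; rewrite -derivable1_diffP.
Qed.

Lemma is_derive_near (R : realType) (f g : R -> R) (x a : R) :
  {near x, f =1 g} -> is_derive x 1 f a -> is_derive x 1 g a.
Proof.
move=> fg [df da]; split; first exact: near_eq_derivable fg df.
by rewrite -da -(near_eq_derive _ fg).
Qed.

Section pointwise_derivatives.
Context {R : realType}.
Implicit Types (f g : R -> R) (x a b c : R).

Lemma is_derive1D f g x a b : is_derive x 1 f a -> is_derive x 1 g b ->
  is_derive x 1 (fun y => f y + g y) (a + b).
Proof. by move=> fa gb; exact: is_deriveD fa gb. Qed.

Lemma is_derive1N f x a : is_derive x 1 f a -> is_derive x 1 (fun y => - f y) (- a).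
Proof. by move=> fa; exact: is_deriveN fa. Qed.

Lemma is_derive1B f g x a b : is_derive x 1 f a -> is_derive x 1 g b ->
  is_derive x 1 (fun y => f y - g y) (a - b).
Proof. by move=> fa gb; exact: is_deriveB fa gb. Qed.

Lemma is_derive1M f g x a b : is_derive x 1 f a -> is_derive x 1 g b ->
  is_derive x 1 (fun y => f y * g y) (f x * b + g x * a).
Proof. by move=> fa gb; exact: is_deriveM fa gb. Qed.

Lemma is_derive1Z f x a c :
  is_derive x 1 f a -> is_derive x 1 (fun y => c * f y) (c * a).
Proof.
move=> fa; have := is_derive1M (is_derive_cst c x 1) fa.
by rewrite mulr0 addr0.
Qed.

Lemma is_derive1X f x a n : is_derive x 1 f a ->
  is_derive x 1 (fun y => f y ^+ n) (n%:R * f x ^+ n.-1 * a).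
Proof.
move=> fa; have h : (fun y => f y ^+ n) = f ^+ n by apply/funext => y; rewrite exprfctE.
by rewrite h; exact: (is_deriveX n fa).
Qed.

Lemma is_derive1V f x a : f x != 0 -> is_derive x 1 f a ->
  is_derive x 1 (fun y => (f y)^-1) (- (f x) ^- 2 * a).
Proof. by move=> f0 fa; exact: is_deriveV f0 fa. Qed.

Lemma is_derive1_compose f g x a b : is_derive (g x) 1 f a -> is_derive x 1 g b ->
  is_derive x 1 (fun y => f (g y)) (a * b).
Proof. by move=> fa gb; exact: is_derive1_comp fa gb. Qed.

Lemma is_derive1_expR f x a : is_derive x 1 f a ->
  is_derive x 1 (fun y => expR (f y)) (expR (f x) * a).
Proof. by move=> fa; exact: is_derive1_compose (is_derive_expR _) fa. Qed.

Lemma is_derive1_eq f x a b : is_derive x 1 f a -> a = b -> is_derive x 1 f b.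
Proof. by move=> fa <-. Qed.

Lemma is_derive1_affine f a b x c :
  is_derive (a * x + b) 1 f c -> is_derive x 1 (fun y => f (a * y + b)) (c * a).
Proof.
move=> fc; have dg : is_derive x 1 (fun y : R => a * y + b) a.
  apply: (is_derive1_eq (is_derive1D (is_derive1Z a (is_derive_id x 1))
    (is_derive_cst b x 1))).
  by rewrite mulr1 addr0.
exact: (@is_derive1_compose f (fun y => a * y + b) x c a).
Qed.

End pointwise_derivatives.

(** The flat functions [x^-n * exp(-1/x)], extended by zero. Powers of [1/x] are included so that
    the derivative of a member is a combination of members. *)
Definition exp_inv (R : realType) (n : nat) (x : R) : R :=
  if 0 < x then x^-1 ^+ n * expR (- x^-1) else 0.

(** Comparing [exp(1/x)] with its Taylor term of degree [n + 2] gives a quadratic bound, enough for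
    a zero derivative at 0. *)
Lemma exp_inv_le (R : realType) (n : nat) (x : R) : 0 < x ->
  exp_inv n x <= n.+2`!%:R * x ^+ 2.
Proof.
move=> x0; rewrite /exp_inv x0.
have := @expR_ge1Dxn R x^-1 n.+1; rewrite invr_ge0 => /(_ (ltW x0)) h.
have h2 : x^-1 ^+ n.+2 / n.+2`!%:R <= expR x^-1.
  by apply: le_trans h; rewrite lerDr.
have f0 : 0 < n.+2`!%:R :> R by rewrite ltr0n fact_gt0.
rewrite expRN ler_pdivrMr ?expR_gt0 // mulrAC.
move: h2; rewrite ler_pdivrMr // => h2.
have -> : x^-1 ^+ n = x^-1 ^+ n.+2 * x ^+ 2.
  by rewrite -addn2 exprD -mulrA -exprMn mulVf ?gt_eqF // expr1n mulr1.
by rewrite ler_pM2r ?exprn_gt0 // mulrC.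
Qed.

Lemma exp_inv_ge0 (R : realType) (n : nat) (x : R) : 0 <= exp_inv n x.
Proof.
rewrite /exp_inv; case: ifP => // x0.
by rewrite mulr_ge0 ?expR_ge0 // exprn_ge0 // invr_ge0 ltW.
Qed.

Lemma is_derive_exp_inv (R : realType) (n : nat) (x : R) :
  is_derive x 1 (exp_inv n) (exp_inv n.+2 x - n%:R * exp_inv n.+1 x).
Proof.
have [x0|x0|->] := ltgtP x 0.
- rewrite /exp_inv !ltNge (ltW x0) /= mulr0 subr0.
  apply: (@is_derive_near _ (cst 0)).
  near=> y => /=; rewrite ltNge; suff /ltW -> : y < 0 by [].
  by near: y; exact: lt_nbhsl.
- rewrite /exp_inv x0.
  apply: (@is_derive_near _ (fun y => y^-1 ^+ n * expR (- y^-1))).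
    near=> y; suff -> : 0 < y by [].
    by near: y; exact: lt_nbhsr.
  have dV : is_derive x 1 (fun y : R => y^-1) (- x^-1 ^+ 2).
    have xn0 : x != 0 by rewrite gt_eqF.
    apply: (is_derive1_eq (@is_derive1V _ id x 1 xn0 (is_derive_id x 1))).
    by rewrite mulr1 exprVn.
  apply: (is_derive1_eq (is_derive1M (is_derive1X n dV) (is_derive1_expR (is_derive1N dV)))).
  rewrite /=; case: n => [|n] /=.
    by rewrite !expr0; ring.
  by rewrite (exprS _ n.+2) (exprS _ n.+1) (exprS _ n); ring.
rewrite /exp_inv ltxx mulr0 subr0.
(* At 0 the difference quotient vanishes from the left, and from the right it is at most
   [(n+2)! * h] by [exp_inv_le]. *)
have hl : (fun h : R => h^-1 *: (exp_inv n (h *: 1 + 0) - exp_inv n 0)) @ 0^' --> (0 : R).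
  apply/cvgr0Pnorm_le => e e0; near=> h.
  have h0 : h != 0 by near: h; exact: nbhs_dnbhs_neq.
  rewrite {2}/exp_inv ltxx subr0 /GRing.scale /= mulr1 addr0.
  rewrite normrM (ger0_norm (exp_inv_ge0 _ _)).
  have [hp|hn] := ltP 0 h; last first.
    by rewrite /exp_inv ltNge hn /= mulr0 ltW.
  rewrite gtr0_norm ?invr_gt0 // ler_pdivrMl //.
  apply: (le_trans (exp_inv_le _ hp)); rewrite expr2 mulrCA ler_pM2l //.
  rewrite -ler_pdivlMl ?ltr0n ?fact_gt0 //.
  apply: le_trans (ler_norm _) _; near: h.
  apply: dnbhs0_le; by rewrite mulr_gt0 // invr_gt0 ltr0n fact_gt0.
by split; [exact: cvgP hl | exact: cvg_lim hl].
Unshelve. all: by end_near. Qed.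

(* A class of functions closed under derivation, so that all its members are smooth
   without any Leibniz or Faa di Bruno formula. *)
Inductive smooth_class (R : realType) : (R -> R) -> Prop :=
| SmoothExp n : smooth_class (exp_inv n)
| SmoothCst c : smooth_class (cst c)
| SmoothD f g : smooth_class f -> smooth_class g -> smooth_class (fun x => f x + g x)
| SmoothM f g : smooth_class f -> smooth_class g -> smooth_class (fun x => f x * g x)
| SmoothV f : (forall x, f x != 0) -> smooth_class f ->
    smooth_class (fun x => (f x)^-1)
| SmoothA a b f : smooth_class f -> smooth_class (fun x => f (a * x + b)).

Lemma smooth_classN (R : realType) (f : R -> R) :
  smooth_class f -> smooth_class (fun x => - f x).
Proof.
move=> sf; have -> : (fun x => - f x) = (fun x => cst (-1) x * f x).
  by apply/funext => x /=; rewrite mulN1r.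
exact: SmoothM (SmoothCst _) sf.
Qed.

Lemma smooth_class_derive (R : realType) (f : R -> R) : smooth_class f ->
  exists2 g : R -> R, smooth_class g & forall x : R, is_derive x 1 f (g x).
Proof.
elim=> {f} [n|c|f g sf [f' sf' df] sg [g' sg' dg]|f g sf [f' sf' df] sg [g' sg' dg]
  |f f0 sf [f' sf' df]|a b f sf [f' sf' df]].
- exists (fun x => exp_inv n.+2 x + cst (- n%:R) x * exp_inv n.+1 x).
    exact: SmoothD (SmoothExp _ _) (SmoothM (SmoothCst _) (SmoothExp _ _)).
  by move=> x; apply: (is_derive1_eq (is_derive_exp_inv n x)); rewrite /= mulNr.
- by exists (cst 0); [exact: SmoothCst | move=> x; exact: (@is_derive_cst R R R _ x 1)].
- by exists (fun x => f' x + g' x); [exact: SmoothD | move=> x; exact: is_derive1D].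
- exists (fun x => f x * g' x + g x * f' x).
    exact: SmoothD (SmoothM sf sg') (SmoothM sg sf').
  by move=> x; exact: is_derive1M.
- exists (fun x => - ((f x)^-1 * (f x)^-1) * f' x).
    apply: SmoothM sf'; apply: smooth_classN; exact: SmoothM (SmoothV _ _) (SmoothV _ _).
  move=> x; apply: (is_derive1_eq (is_derive1V (f0 x) (df x))).
  by rewrite -expr2 exprVn.
- exists (fun x => f' (a * x + b) * cst a x).
    exact: SmoothM (SmoothA _ _ sf') (SmoothCst _).
  by move=> x; exact: is_derive1_affine.
Qed.

Lemma smooth_class_derive1n (R : realType) (f : R -> R) (n : nat) :
  smooth_class f -> smooth_class (derive1n n f).
Proof.
move=> sf; elim: n => // n /smooth_class_derive[g sg dg].
rewrite derive1nS; suff -> : derive1 (derive1n n f) = g by [].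
by apply/funext => x; exact: is_derive1_derive1.
Qed.

Lemma smooth_class_derivable (R : realType) (f : R -> R) (n : nat) (x : R) :
  smooth_class f -> derivable (derive1n n f) x 1.
Proof.
by move=> /(smooth_class_derive1n n)/smooth_class_derive[g _ /(_ x)[]].
Qed.

(** Rescaled, [s] acts as an approximate identity, and a difference of two shifted copies of [S] as
    a smoothed indicator of an interval. *)
Record smooth_step (R : realType) (S s : R -> R) (M : R) : Prop := SmoothStep {
  step_smooth : smooth_class S ;
  step_continuous : continuous s ;
  step_derive : forall x : R, is_derive x 1 S (s x) ;
  step_left : forall x, x <= 0 -> S x = 0 /\ s x = 0 ;
  step_right : forall x, 1 <= x -> S x = 1 /\ s x = 0 ;
  step_bound : forall x, `|S x| <= M /\ `|s x| <= M }.

(** The quotient [e(x) / (e(x) + e(1 - x))] with [e = exp_inv 0]. Its denominator never vanishes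
    because [x] and [1 - x] are not both nonpositive. *)
Lemma exists_smooth_step (R : realType) : exists (S s : R -> R) (M : R), smooth_step S s M.
Proof.
pose e := @exp_inv R 0.
pose q x := e x + e (-1 * x + 1).
have q0 x : q x != 0.
  rewrite gt_eqF // /q; have [x0|x0] := ltP 0 x.
    by rewrite ltr_wpDr ?exp_inv_ge0 // /e /exp_inv x0 expr0 mul1r expR_gt0.
  rewrite ltr_wpDl ?exp_inv_ge0 // /e /exp_inv; case: ifPn.
    by rewrite expr0 mul1r expR_gt0.
  rewrite -leNgt; lra.
pose S x := e x * (q x)^-1.
have sS : smooth_class S.
  apply: SmoothM; first exact: SmoothExp.
  apply: SmoothV => //; apply: SmoothD; first exact: SmoothExp.
  exact: (@SmoothA _ (-1) 1 e (SmoothExp _ _)).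
have [s ss dS] := smooth_class_derive sS.
have cs : continuous s.
  by move=> x; have [g _ dg] := smooth_class_derive ss; exact: is_derive_continuous.
have S0 x : x <= 0 -> S x = 0.
  by move=> x0; rewrite /S /e /exp_inv ltNge x0 mul0r.
have S1 x : 1 <= x -> S x = 1.
  move=> x1; rewrite /S; have -> : e x = q x; last by rewrite mulfV.
  rewrite /q /e {3}/exp_inv; case: ifPn; last by rewrite addr0.
  lra.
(* The derivative vanishes on any open set where [S] is constant; the endpoints 0 and 1 are then
   reached by continuity of [s]. *)
have s_out (c : R) (A : set R) x : open A -> A x -> (forall y, A y -> S y = c) -> s x = 0.
  move=> oA Ax Sc; rewrite -(is_derive1_derive1 (dS x)).
  apply: is_derive1_derive1; apply: (@is_derive_near _ (cst c)).
  near=> y; rewrite Sc //; near: y; exact: open_nbhs_nbhs.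
have s0' x : x < 0 -> s x = 0.
  move=> x0; apply: (@s_out 0 [set y | y < 0]) => //.
  by move=> y /ltW /S0.
have s1' x : 1 < x -> s x = 0.
  move=> x0; apply: (@s_out 1 [set y | 1 < y]) => //.
  by move=> y /ltW /S1.
have slim (x : R) (F : set_system R) : ProperFilter F -> F --> x ->
    (\forall y \near F, s y = 0) -> s x = 0.
  move=> PF Fx Fs; have h1 : s @ F --> s x by apply: cvg_trans (cs x); exact: cvg_app.
  have h2 : s @ F --> (0 : R).
    apply: cvg_near_cst; exact: Fs.
  exact: (cvg_unique _ h1 h2).
have s0 x : x <= 0 -> s x = 0.
  rewrite le_eqVlt => /predU1P[->|/s0'//].
  apply: (@slim 0 (0^'-)); first exact: cvg_at_left_filter.
  by near=> y; apply: s0'; near: y; exact: nbhs_left_lt.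
have s1 x : 1 <= x -> s x = 0.
  rewrite le_eqVlt => /predU1P[<-|/s1'//].
  apply: (@slim 1 (1^'+)); first exact: cvg_at_right_filter.
  by near=> y; apply: s1'; near: y; exact: nbhs_right_gt.
(* A maximum over [[0, 1]] suffices, the function being constant on either side of it. *)
have bnd (f : R -> R) (c : R) : continuous f -> (forall x, x <= 0 -> f x = 0) ->
    (forall x, 1 <= x -> f x = c) -> exists M, forall x, `|f x| <= M.
  move=> cf f0 f1.
  have : {within `[0, 1], continuous (fun x => `|f x|)}.
    by apply: continuous_subspaceT => x; apply: continuous_comp;
      [exact: cf | exact: norm_continuous].
  move=> /(EVT_max ler01)[z _ hz]; exists (`|f z| + `|c|) => x.
  have [x0|x0] := leP x 0; first by rewrite f0 // normr0 addr_ge0.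
  have [x1|x1] := leP 1 x; first by rewrite f1 // lerDr.
  by rewrite (le_trans (hz x _)) ?lerDl // in_itv /= !ltW.
have [M1 hM1] : exists M, forall x, `|S x| <= M.
  by apply: (bnd S 1) => // x; exact: is_derive_continuous (dS x).
have [M2 hM2] := bnd s 0 cs s0 s1.
exists S, s, (Num.max M1 M2); split => // x; [by move=> ?; rewrite S0 ?s0| |].
  by move=> ?; rewrite S1 ?s1.
by rewrite !le_max hM1 hM2 orbT.
Unshelve. all: by end_near. Qed.

(** * Square-integrable functions *)

Section lebesgue_tools.
Context {R : realType}.
Implicit Types (f g h phi : R -> R) (a b x : R) (D : set (measurableTypeR R)).
Notation mu := (@lebesgue_measure R).

Lemma ae_lebesgueS (P Q : R -> Prop) : (forall x, P x -> Q x) ->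
  {ae mu, forall x, P x} -> {ae mu, forall x, Q x}.
Proof. exact: (@filterS _ _ (@ae_filter_ringOfSetsType _ _ R mu)). Qed.

Lemma ae_lebesgueS2 (P Q S : R -> Prop) : (forall x, P x -> Q x -> S x) ->
  {ae mu, forall x, P x} -> {ae mu, forall x, Q x} -> {ae mu, forall x, S x}.
Proof. exact: (@filterS2 _ _ (@ae_filter_ringOfSetsType _ _ R mu)). Qed.

(** Otherwise the interval would lie in a null set, although its measure [b - a] is positive. *)
Lemma ae_lebesgue_dense (P : R -> Prop) a b : a < b ->
  {ae mu, forall x, P x} -> exists x, a < x < b /\ P x.
Proof.
move=> ab [N [mN N0 PN]]; apply: contrapT => noP.
have sub : `]a, b[ `<=` N.
  move=> x /=; rewrite in_itv /= => xab; apply: PN => /= Px.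
  by apply: noP; exists x.
have : (mu `]a, b[%classic <= mu N)%E by apply: le_measure; rewrite ?inE.
rewrite N0 /= lebesgue_measure_itv /= lte_fin ab -EFinB lee_fin subr_le0.
by rewrite leNgt ab.
Qed.

Lemma support_patch D f : (forall x, ~ D x -> f x = 0) -> f \_ D = f.
Proof.
move=> f0; apply/funext => x; rewrite patchE; case: ifPn => // xD.
by rewrite f0 // => Dx; rewrite mem_set in xD.
Qed.

Lemma Rintegral_support D f : (forall x, ~ D x -> f x = 0) ->
  Rintegral mu setT f = Rintegral mu D f.
Proof. by move=> /support_patch f0; rewrite [RHS]Rintegral_mkcond f0. Qed.

Lemma integrable_support D f : measurable D -> (forall x, ~ D x -> f x = 0) ->
  mu.-integrable D (EFin \o f) -> mu.-integrable setT (EFin \o f).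
Proof.
move=> mD /support_patch f0; by rewrite integrable_mkcond // restrict_EFin f0.
Qed.

Lemma integrable_mul_bounded D f phi (M : R) : measurable D ->
  mu.-integrable D (EFin \o f) -> measurable_fun setT phi ->
  (forall x, `|phi x| <= M) -> mu.-integrable D (EFin \o (fun x => f x * phi x)).
Proof.
move=> mD fi mphi bphi.
have := @integrableMl _ _ _ mu D mD (EFin \o f) phi fi.
apply.
  exact: measurable_funTS.
exists M; split; first exact: num_real.
by move=> y My x _ /=; rewrite (le_trans (bphi x)) // ltW.
Qed.

Lemma integrableD_EFin D f g : measurable D ->
  mu.-integrable D (EFin \o f) -> mu.-integrable D (EFin \o g) ->
  mu.-integrable D (EFin \o (fun x => f x + g x)).
Proof. by move=> mD fi gi; apply: (integrableD mD fi gi). Qed.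

Lemma integrableB_EFin D f g : measurable D ->
  mu.-integrable D (EFin \o f) -> mu.-integrable D (EFin \o g) ->
  mu.-integrable D (EFin \o (fun x => f x - g x)).
Proof. by move=> mD fi gi; apply: (integrableB mD fi gi). Qed.

Lemma integrableZ_EFin D (c : R) f : measurable D ->
  mu.-integrable D (EFin \o f) -> mu.-integrable D (EFin \o (fun x => c * f x)).
Proof. by move=> mD fi; apply: (integrableZl mD c fi). Qed.

(** Domination by [1 + f ^ 2], which is integrable because the interval is bounded. *)
Lemma L2_integrable_itv f a b : L2 f -> mu.-integrable `[a, b] (EFin \o f).
Proof.
move=> [mf f2].
have i2 : mu.-integrable `[a, b] (EFin \o (fun x => f x ^+ 2)).
  exact: (integrableS measurableT).
have i1 : mu.-integrable `[a, b] (EFin \o cst 1).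
  apply: measurable_bounded_integrable => //=.
    by rewrite lebesgue_measure_itv /=; case: ifP => // _; rewrite -EFinD ltry.
  exists 1; split; first exact: num_real.
  by move=> y y1 x _ /=; rewrite normr1 ltW.
have i3 : mu.-integrable `[a, b] ((EFin \o cst 1) \+ (EFin \o (fun x => f x ^+ 2))).
  exact: integrableD.
apply: le_integrable i3 => //.
  by apply/measurable_EFinP; exact: measurable_funTS.
move=> x _ /=; rewrite lee_fin [leRHS]ger0_norm; last first.
  by rewrite addr_ge0 // sqr_ge0.
rewrite -real_normK ?num_real //.
have := normr_ge0 (f x); nra.
Qed.

(** Gives access to Lebesgue differentiation: almost every point is a Lebesgue point of [f]. *)
Lemma L2_locally_integrable f : L2 f -> locally_integrable setT f.
Proof.
move=> fL2; have [mf _] := fL2; split => //; first exact: openT.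
move=> K _ cK; have /compact_bounded[M [Mr KM]] := cK.
have {}KM : K `<=` `[- (`|M| + 1), `|M| + 1].
  move=> x Kx /=; rewrite in_itv /= -ler_norml; apply: KM => //.
  by rewrite (le_lt_trans (ler_norm M)) // ltrDl.
have /integrableP[_] := L2_integrable_itv (- (`|M| + 1)) (`|M| + 1) fL2.
apply: le_lt_trans; apply: ge0_subset_integral => //.
- exact: compact_measurable.
- by do 2 apply: measurableT_comp => //; exact: measurable_funTS.
Qed.

Lemma L2D f g : L2 f -> L2 g -> L2 (fun x => f x + g x).
Proof.
move=> [mf f2] [mg g2]; split; first exact: measurable_funD.
(* The dominating function is [2 f^2 + 2 g^2]; it exceeds [(f + g)^2] by [(f - g)^2]. *)
have fg : mu.-integrable setT
    ((fun x => 2%:E * (f x ^+ 2)%:E)%E \+ (fun x => 2%:E * (g x ^+ 2)%:E)%E).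
  by apply: integrableD => //; exact: integrableZl.
apply: le_integrable fg => //.
  apply/measurable_EFinP; apply: measurable_funX; exact: measurable_funD.
move=> x _ /=; rewrite lee_fin !ger0_norm ?sqr_ge0 //; last first.
  by rewrite addr_ge0 // mulr_ge0 // sqr_ge0.
have := sqr_ge0 (f x - g x); nra.
Qed.

Lemma L2Z (c : R) f : L2 f -> L2 (fun x => c * f x).
Proof.
move=> [mf f2]; split; first exact: measurable_funM.
have /(integrableZl measurableT (c ^+ 2)) := f2.
by apply: eq_integrable => // x _ /=; rewrite -EFinM exprMn.
Qed.

Lemma L2B f g : L2 f -> L2 g -> L2 (fun x => f x - g x).
Proof.
move=> f2 g2; have := L2D f2 (L2Z (-1) g2).
by under eq_fun do rewrite mulN1r.
Qed.

Lemma ae_eq_Rintegral D f g : measurable D ->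
  mu.-integrable D (EFin \o f) -> measurable_fun setT g ->
  {ae mu, forall x, f x = g x} ->
  mu.-integrable D (EFin \o g) /\ Rintegral mu D f = Rintegral mu D g.
Proof.
move=> mD fi mg fg; have mf := measurable_int _ fi.
have mg' : measurable_fun D (EFin \o g) by apply/measurable_EFinP; exact: measurable_funTS.
split.
  apply/integrableP; split => //; have /integrableP[_] := fi.
  congr (_ < _)%E; apply: ae_eq_integral => //.
  - exact: measurableT_comp.
  - exact: measurableT_comp.
  - by move: fg; apply: ae_lebesgueS => x /= -> _.
congr fine; apply: ae_eq_integral => //.
by move: fg; apply: ae_lebesgueS => x /= -> _.
Qed.

End lebesgue_tools.

(** * The fundamental theorem of calculus *)

Section calculus.
Context {R : realType}.
Implicit Types (f g F : R -> R) (a b x : R).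
Notation mu := (@lebesgue_measure R).

Lemma continuous_integrable_itv f a b : continuous f ->
  mu.-integrable `[a, b] (EFin \o f).
Proof.
move=> cf; apply: continuous_compact_integrable; first exact: segment_compact.
exact: continuous_subspaceT.
Qed.

Lemma Rintegral_derive F f a b : a <= b -> continuous f ->
  (forall x : R, is_derive x 1 F (f x)) -> Rintegral mu `[a, b] f = F b - F a.
Proof.
rewrite le_eqVlt => /predU1P[->|ab] cf dF.
  by rewrite set_itv1 Rintegral_set1 subrr.
have cF x : {for x, continuous F} by exact: is_derive_continuous (dF x).
rewrite /Rintegral (@continuous_FTC2 _ f F) //.
- exact: continuous_subspaceT.
- split.
  + by move=> x _; case: (dF x).
  + by apply: cvg_at_right_filter; exact: cF.
  + by apply: cvg_at_left_filter; exact: cF.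
- by move=> x _; exact: is_derive1_derive1.
Qed.

(** Near [x], [F] differs by a constant from the integral of [f] started at [x - 1], a base point
    that keeps [x] in the interior. *)
Lemma is_derive_primitive F f (x : R) : continuous f ->
  (forall a b, a <= b -> F b - F a = Rintegral mu `[a, b] f) -> is_derive x 1 F (f x).
Proof.
move=> cf FE.
have x1x : x - 1 < x by rewrite ltrBlDr ltrDl.
have xx1 : x < x + 1 by rewrite ltrDl.
have [dG vG] := @continuous_FTC1 _ f (BLeft (x - 1)) x (x + 1) xx1
  (continuous_integrable_itv _ _ cf) x1x (cf x).
pose G y := Rintegral mu `[x - 1, y] f.
have G' : is_derive x 1 G (f x).
  by split => //; rewrite -derive1E.
have := is_derive1D (is_derive_cst (F (x - 1)) x 1) G'; rewrite add0r.
apply: is_derive_near; near=> y => /=.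
rewrite /G -FE ?subrKC //; apply: ltW; near: y; exact: lt_nbhsr.
Unshelve. all: by end_near. Qed.

End calculus.

(** * Weak derivatives and Sobolev representatives *)

Section weak_derivative.
Context {R : realType}.
Implicit Types (f g S s : R -> R) (a b x e M : R).
Notation mu := (@lebesgue_measure R).

(** Converts the mean deviation that defines [lebesgue_pt] into a plain integral; its finiteness
    lets [fine] pass through the product. *)
Lemma davg_Rintegral f a e : 0 < e -> L2 f -> davg f a e \is a fin_num ->
  Rintegral mu (ball a e) (fun x => `|f x - f a|) = e *+ 2 * fine (davg f a e).
Proof.
move=> e0 f2; rewrite /davg /iavg lebesgue_measure_ball ?ltW // inver.
have e2 : e *+ 2 != 0 by rewrite gt_eqF // mulrn_wgt0.
rewrite (negbTE e2) /Rintegral => dfin.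
rewrite fineM //; last first.
  have ei0 : (0 < ((e *+ 2)^-1)%:E)%E by rewrite lte_fin invr_gt0 mulrn_wgt0.
  move: dfin; case: (integral _ _ _) => [r| |] //.
  - by rewrite gt0_muley.
  - by rewrite gt0_muleNy.
by rewrite /= mulrA mulfV // mul1r.
Qed.

(** The rescaled [s] is supported in [[a, a + e]], has mass 1 and is bounded by [M / e]. The error
    is thus at most [4 M] times the mean of [|f - f a|] over a ball of radius [2 e], which tends to
    0 at a Lebesgue point. *)
Lemma step_integral_cvg f S s M a : smooth_step S s M -> L2 f -> lebesgue_pt f a ->
  forall eta, 0 < eta -> \forall e \near 0^'+,
  `|Rintegral mu setT (fun x => f x * (s (e^-1 * x - e^-1 * a) * e^-1)) - f a| <= eta.
Proof.
move=> Ss f2 /fine_cvgP[davg_fin davg0] eta eta0; have [mf _] := f2.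
have M0 : 0 <= M by have [+ _] := step_bound Ss 0; apply: le_trans.
(* The radius is doubled so that the open ball contains the closed interval [[a, a + e]]. Below,
   [M + 1] replaces [M] as a divisor since [M] may be 0. *)
have dbl (P : R -> Prop) : (\forall r \near 0^'+, P r) -> \forall e \near 0^'+, P (2 * e).
  move=> [d /= d0 dP]; exists (d / 2); first by rewrite /= divr_gt0.
  move=> e /=; rewrite sub0r normrN => ed e0; apply: dP; last by rewrite mulr_gt0.
  by rewrite /= sub0r normrN normrM ger0_norm // -ltr_pdivlMl // mulrC.
have dsmall : \forall e \near 0^'+, `|fine (davg f a (2 * e))| <= eta / (4 * (M + 1)).
  apply: (dbl (fun r => `|fine (davg f a r)| <= eta / (4 * (M + 1)))).
  by move/cvgr0Pnorm_le : davg0; apply; rewrite divr_gt0 // mulr_gt0 // ltr_wpDl.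
have dfins := dbl _ davg_fin.
near=> e.
have e0 : 0 < e by near: e; exact: nbhs_right_gt.
have dfin : davg f a (2 * e) \is a fin_num by near: e.
have dle : `|fine (davg f a (2 * e))| <= eta / (4 * (M + 1)) by near: e.
have ei0 : 0 < e^-1 by rewrite invr_gt0.
pose k x := s (e^-1 * x - e^-1 * a) * e^-1.
pose I : set (measurableTypeR R) := `[a, a + e]%classic.
have ae : a <= a + e by rewrite lerDl ltW.
have kout x : ~ I x -> k x = 0.
  rewrite /I /= in_itv /= => /negP; rewrite negb_and -!ltNge /k -mulrBr => /orP[xa|xa].
    have h : e^-1 * (x - a) <= 0 by rewrite pmulr_rle0 // subr_le0 ltW.
    by have [_ ->] := step_left Ss h; rewrite mul0r.
  have h : 1 <= e^-1 * (x - a) by rewrite ler_pdivlMl // mulr1 lerBrDl ltW.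
  by have [_ ->] := step_right Ss h; rewrite mul0r.
have kM x : `|k x| <= M / e.
  rewrite /k normrM (ger0_norm (ltW ei0)) ler_wpM2r ?(ltW ei0) //.
  by have [_] := step_bound Ss (e^-1 * x - e^-1 * a).
have ck : continuous k.
  have ca x : {for x, continuous (fun x => e^-1 * x - e^-1 * a)}.
    apply: (@cvgB _ _ _ _ _ (fun x => e^-1 * x) (cst (e^-1 * a))).
      exact: mulrl_continuous.
    exact: cvg_cst.
  move=> x; apply: (@cvgM _ _ _ _ (fun x => s (e^-1 * x - e^-1 * a)) (cst e^-1)); last exact: cvg_cst.
  apply: (@continuous_comp _ _ _ (fun x => e^-1 * x - e^-1 * a) s) => //.
  exact: step_continuous Ss _.
have mk : measurable_fun setT k by exact: continuous_measurable_fun.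
have k1 : Rintegral mu I k = 1.
  have dS (x : R) : is_derive x 1 (fun y => S (e^-1 * y - e^-1 * a)) (k x).
    exact: is_derive1_affine (step_derive Ss _).
  rewrite (Rintegral_derive ae ck dS).
  have h1 : 1 <= e^-1 * (a + e) - e^-1 * a.
    by rewrite mulrDr mulVf ?gt_eqF // addrAC subrr add0r.
  have h0 : e^-1 * a - e^-1 * a <= 0 by rewrite subrr.
  by have [-> _] := step_right Ss h1; have [-> _] := step_left Ss h0; rewrite subr0.
have fI : mu.-integrable I (EFin \o f) by exact: L2_integrable_itv.
have fkI : mu.-integrable I (EFin \o (fun x => f x * k x)).
  by apply: (integrable_mul_bounded _ _ mk kM) => //; exact: measurable_itv.
have kI : mu.-integrable I (EFin \o k) by exact: continuous_integrable_itv.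
have fakI : mu.-integrable I (EFin \o (fun x => f a * k x)).
  by apply: continuous_integrable_itv => x;
    apply: (@cvgM _ _ _ _ (cst (f a)) k); [exact: cvg_cst|exact: ck].
have mI : measurable I by exact: measurable_itv.
rewrite (@Rintegral_support _ I); last by move=> x /kout; rewrite /k => ->; rewrite mulr0.
rewrite -[X in _ - X]mulr1 -k1 -RintegralZl // -RintegralB //.
pose J : set (measurableTypeR R) := `[a - 2 * e, a + 2 * e]%classic.
have mJ : measurable J by exact: measurable_itv.
have mB : measurable (ball a (2 * e) : set (measurableTypeR R)) by exact: measurable_ball.
have hJ : mu.-integrable J (EFin \o (fun x => `|f x - f a|)).
  apply: (@integrable_norm _ _ _ mu J (fun x => f x - f a)).
  apply: integrableB_EFin => //; first exact: L2_integrable_itv.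
  by apply: (@continuous_integrable_itv _ (cst (f a))) => x; exact: cvg_cst.
have hB : mu.-integrable (ball a (2 * e)) (EFin \o (fun x => `|f x - f a|)).
  apply: integrableS hJ => // x; rewrite ball_itv /J /= !in_itv /= => /andP[h1 h2].
  by rewrite !ltW.
have hI : mu.-integrable I (EFin \o (fun x => `|f x - f a|)).
  apply: integrableS hJ => // x; rewrite /I /J /= !in_itv /= => /andP[h1 h2].
  by apply/andP; split; lra.
apply: (@le_trans _ _ (Rintegral mu I (fun x => (M / e) * `|f x - f a|))).
  apply: le_trans (le_normr_Rintegral _ _) _ => //; first exact: integrableB_EFin.
  apply: le_Rintegral => //.
  - by apply: integrable_norm; exact: integrableB_EFin.
  - exact: integrableZ_EFin.
  - by move=> x _ /=; rewrite -mulrBl normrM mulrC; apply: ler_wpM2r => //; exact: kM.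
rewrite RintegralZl //.
have e20 : 0 < 2 * e by rewrite mulr_gt0.
have E := davg_Rintegral e20 f2 dfin.
apply: (@le_trans _ _ (M / e * Rintegral mu (ball a (2 * e)) (fun x => `|f x - f a|))).
  rewrite ler_wpM2l ?divr_ge0 ?(ltW e0) //; apply: fine_le.
  - exact: integrable_fin_num.
  - exact: integrable_fin_num.
  - apply: ge0_subset_integral => //; first exact: measurable_int hB.
    move=> x; rewrite ball_itv /I /= !in_itv /= => /andP[h1 h2].
    by apply/andP; split; lra.
rewrite E.
have -> : M / e * ((2 * e) *+ 2 * fine (davg f a (2 * e))) =
    4 * M * fine (davg f a (2 * e)).
  by rewrite -mulr_natl; field; rewrite gt_eqF.
have := ler_norm (fine (davg f a (2 * e))).
move/le_trans => /(_ _ dle) h.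
have : 4 * M * fine (davg f a (2 * e)) <= 4 * M * (eta / (4 * (M + 1))).
  by rewrite ler_wpM2l // mulr_ge0.
move/le_trans; apply.
have -> : 4 * M * (eta / (4 * (M + 1))) = eta * (M / (M + 1)).
  by field; rewrite gt_eqF // ltr_wpDl.
by rewrite ger_pMr // ler_pdivrMr ?ltr_wpDl // mul1r lerDl.
Unshelve. all: by end_near. Qed.

(** The smoothed indicator differs from that of [[a, b]] only on [[a, a + e]] and [[b, b + e]], by
    at most [M + 1], and the integral of [|g|] over these intervals vanishes as [e] shrinks. *)
Lemma step_mul_cvg g S s M a b : smooth_step S s M -> L2 g -> a < b ->
  forall eta, 0 < eta -> \forall e \near 0^'+,
  `|Rintegral mu setT (fun x => g x * (S (e^-1 * x - e^-1 * a) - S (e^-1 * x - e^-1 * b)))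
    - Rintegral mu `[a, b] g| <= eta.
Proof.
move=> Ss g2 ab eta eta0.
have M0 : 0 <= M by have [+ _] := step_bound Ss 0; apply: le_trans.
have near_small c : \forall e \near 0^'+,
    Rintegral mu `[c, c + e] (fun x => `|g x|) <= eta / (2 * (M + 1)).
  have gi : mu.-integrable `[c, c + 1] (EFin \o (fun x => `|g x|)).
    by apply: integrable_norm; exact: L2_integrable_itv.
  have cc1 : c < c + 1 by rewrite ltrDl.
  have eta'0 : 0 < eta / (2 * (M + 1)) by rewrite divr_gt0 // mulr_gt0 // ltr_wpDl.
  have [d /= d0 dP] := parameterized_integral_near_left cc1 eta'0 gi.
  exists d => // e /=; rewrite sub0r normrN => ed e0.
  have := dP (c + e); rewrite /= opprD addNKr normrN => /(_ ed).
  by rewrite lerDl (ltW e0) => /(_ isT)/ltW; apply: le_trans; exact: ler_norm.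
near=> e.
have e0 : 0 < e by near: e; exact: nbhs_right_gt.
(* Keeps the two transition intervals disjoint. *)
have eb : e < b - a by near: e; apply: nbhs_right_lt; rewrite subr_gt0.
have ha : Rintegral mu `[a, a + e] (fun x => `|g x|) <= eta / (2 * (M + 1)).
  by near: e; exact: near_small.
have hb : Rintegral mu `[b, b + e] (fun x => `|g x|) <= eta / (2 * (M + 1)).
  by near: e; exact: near_small.
pose phi x := S (e^-1 * x - e^-1 * a) - S (e^-1 * x - e^-1 * b).
pose chi (I : set (measurableTypeR R)) x : R := \1_I x.
pose I := `[a, b]%classic : set (measurableTypeR R).
pose A := `[a, a + e]%classic : set (measurableTypeR R).
pose B := `[b, b + e]%classic : set (measurableTypeR R).
pose J := `[a, b + e]%classic : set (measurableTypeR R).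
have Sl c x : x <= c -> S (e^-1 * x - e^-1 * c) = 0.
  move=> xc; have h : e^-1 * x - e^-1 * c <= 0.
    by rewrite -mulrBr pmulr_rle0 ?invr_gt0 // subr_le0.
  by have [-> _] := step_left Ss h.
have Sr c x : c + e <= x -> S (e^-1 * x - e^-1 * c) = 1.
  move=> xc; have h : 1 <= e^-1 * x - e^-1 * c.
    by rewrite -mulrBr ler_pdivlMl // mulr1 lerBrDl.
  by have [-> _] := step_right Ss h.
have SM x : `|S x| <= M by have [] := step_bound Ss x.
have phiJ x : ~ J x -> phi x = 0.
  rewrite /J /phi /= in_itv /= => /negP; rewrite negb_and -!ltNge => /orP[xa|xb].
    by rewrite !Sl ?subrr // ltW // (lt_trans xa).
  by rewrite !Sr ?subrr //; lra.
have phi_diff x : `|phi x - chi I x| <= (M + 1) * (chi A x + chi B x).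
  have hA : (0 : R) <= chi A x by [].
  have hB : (0 : R) <= chi B x by [].
  have [xa|xa] := ltP x a.
    have -> : chi I x = 0.
      by rewrite /chi indicE memNset // /I /= in_itv /= leNgt xa.
    rewrite /phi !Sl ?(ltW xa) ?(ltW (lt_trans xa ab)) // !subr0 normr0.
    by rewrite mulr_ge0 // addr_ge0.
  have [xae|xae] := leP x (a + e).
    have -> : chi A x = 1 by rewrite /chi indicE mem_set // /A /= in_itv /= xa xae.
    have xb : x <= b by lra.
    have -> : chi I x = 1 by rewrite /chi indicE mem_set // /I /= in_itv /= xa xb.
    rewrite /phi (Sl b) // subr0; apply: (@le_trans _ _ (M + 1)).
      by rewrite (le_trans (ler_normB _ _)) // normr1 lerD2r.
    by rewrite ler_peMr ?addr_ge0 // lerDl.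
  have Sa : S (e^-1 * x - e^-1 * a) = 1 by rewrite Sr // ltW.
  have [xb|xb] := leP x b.
    have -> : chi I x = 1 by rewrite /chi indicE mem_set // /I /= in_itv /= xa xb.
    rewrite /phi Sa (Sl b) // subr0 subrr normr0.
    by rewrite mulr_ge0 // addr_ge0.
  have -> : chi I x = 0.
    by rewrite /chi indicE memNset // /I /= in_itv /= [x <= b]leNgt xb andbF.
  rewrite subr0.
  have [xbe|xbe] := leP x (b + e).
    have -> : chi B x = 1 by rewrite /chi indicE mem_set // /B /= in_itv /= (ltW xb) xbe.
    apply: (@le_trans _ _ (M + 1)).
      by rewrite /phi Sa (le_trans (ler_normB _ _)) // normr1 addrC lerD2r.
    by rewrite ler_peMr ?addr_ge0 // lerDr.
  by rewrite /phi Sa (Sr b) ?(ltW xbe) // subrr normr0 mulr_ge0 // addr_ge0.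
have cS c : continuous (fun x => S (e^-1 * x - e^-1 * c)).
  move=> x; apply: is_derive_continuous.
  exact: is_derive1_affine (step_derive Ss _).
have mphi : measurable_fun setT phi.
  by apply: measurable_funB; exact: continuous_measurable_fun.
have phiM x : `|phi x| <= M + M by rewrite (le_trans (ler_normB _ _)) // lerD.
have mJ : measurable J by exact: measurable_itv.
have gphi : mu.-integrable setT (EFin \o (fun x => g x * phi x)).
  apply: (@integrable_support _ J) => //; first by move=> x /phiJ ->; rewrite mulr0.
  by apply: (integrable_mul_bounded _ _ mphi phiM) => //; exact: L2_integrable_itv.
have gchi h (c d : R) : mu.-integrable `[c, d] (EFin \o h) ->
    mu.-integrable setT (EFin \o (fun x => h x * chi `[c, d]%classic x)) /\
    Rintegral mu setT (fun x => h x * chi `[c, d]%classic x) = Rintegral mu `[c, d] h.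
  move=> hi; have E x : `[c, d]%classic x -> h x * chi `[c, d]%classic x = h x.
    by move=> cdx; rewrite /chi indicE mem_set // mulr1.
  have Z x : ~ `[c, d]%classic x -> h x * chi `[c, d]%classic x = 0.
    by move=> cdx; rewrite /chi indicE memNset // mulr0.
  split.
    apply: (@integrable_support _ `[c, d]%classic) => //.
    by apply: eq_integrable hi => // x /set_mem /E /= ->.
  by rewrite (Rintegral_support Z); apply: eq_Rintegral => x /set_mem /E.
have [gI gIE] := gchi g a b (L2_integrable_itv a b g2).
rewrite -gIE -RintegralB //.
have gn c d : mu.-integrable `[c, d] (EFin \o (fun x => `|g x|)).
  by apply: integrable_norm; exact: L2_integrable_itv.
have [gA gAE] := gchi _ _ _ (gn a (a + e)).
have [gB gBE] := gchi _ _ _ (gn b (b + e)).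
apply: (@le_trans _ _ (Rintegral mu setT (fun x => (M + 1) *
    (`|g x| * chi A x + `|g x| * chi B x)))).
  apply: le_trans (le_normr_Rintegral _ _) _ => //; first exact: integrableB_EFin.
  apply: le_Rintegral => //.
  - by apply: integrable_norm; exact: integrableB_EFin.
  - by apply: integrableZ_EFin => //; exact: integrableD_EFin.
  - move=> x _; rewrite -mulrBr normrM -mulrDr mulrCA.
    by apply: ler_wpM2l => //; exact: phi_diff.
rewrite RintegralZl //; last exact: integrableD_EFin.
rewrite RintegralD // gAE gBE.
apply: (@le_trans _ _ ((M + 1) * (eta / (2 * (M + 1)) + eta / (2 * (M + 1))))).
  by rewrite ler_wpM2l ?addr_ge0 // lerD.
suff -> : (M + 1) * (eta / (2 * (M + 1)) + eta / (2 * (M + 1))) = eta by [].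
by field; rewrite gt_eqF // ltr_wpDl.
Unshelve. all: by end_near. Qed.

(** Both copies of [S] vanish left of [a] and equal 1 right of [b + e], hence compact support. *)
Lemma test_fun_step S s M a b e : smooth_step S s M -> a <= b -> 0 < e ->
  test_fun (fun x => S (e^-1 * x - e^-1 * a) - S (e^-1 * x - e^-1 * b)).
Proof.
move=> Ss ab e0; have e'0 : 0 < e^-1 by rewrite invr_gt0.
split.
  move=> n x; apply: smooth_class_derivable.
  apply: (SmoothD (SmoothA e^-1 (- (e^-1 * a)) (step_smooth Ss))).
  apply: smooth_classN.
  exact: (SmoothA e^-1 (- (e^-1 * b)) (step_smooth Ss)).
exists (Num.max `|a| `|b + e|) => x; rewrite gt_max => /andP[xa xb].
have [x0|x0] := leP 0 x.
  have {}xb : b + e < x.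
    by rewrite (le_lt_trans (ler_norm _)) // (lt_le_trans xb) // ger0_norm.
  have h1 : 1 <= e^-1 * x - e^-1 * a by rewrite -mulrBr ler_pdivlMl // mulr1; lra.
  have h2 : 1 <= e^-1 * x - e^-1 * b by rewrite -mulrBr ler_pdivlMl // mulr1; lra.
  by have [-> _] := step_right Ss h1; have [-> _] := step_right Ss h2; rewrite subrr.
have {}xa : x < a.
  rewrite -ltrN2; apply: le_lt_trans (_ : `|a| < _).
    by rewrite -normrN ler_norm.
  by rewrite (lt_le_trans xa) // ltr0_norm.
have h1 : e^-1 * x - e^-1 * a <= 0 by rewrite -mulrBr pmulr_rle0 //; lra.
have h2 : e^-1 * x - e^-1 * b <= 0 by rewrite -mulrBr pmulr_rle0 //; lra.
by have [-> _] := step_left Ss h1; have [-> _] := step_left Ss h2; rewrite subrr.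
Qed.

(** Tested against a smoothed indicator, the weak derivative gives [X - Y = - Z], where [X], [Y],
    [Z] tend to [f a], [f b] and the integral of [g]. Each of the three errors is allowed
    [eta / 3]. *)
Lemma weak_deriv_lebesgue_pt f g a b : L2 f -> L2 g -> weak_deriv 1 f g ->
  lebesgue_pt f a -> lebesgue_pt f b -> a < b ->
  f b - f a = Rintegral mu `[a, b] g.
Proof.
move=> f2 g2 fg La Lb ab.
have [S [s [M Ss]]] := exists_smooth_step R.
apply/eqP; rewrite -subr_eq0 -normr_le0; apply/ler_addgt0Pl => eta eta0.
rewrite addr0.
have eta3 : 0 < eta / 3 by rewrite divr_gt0.
have na := step_integral_cvg Ss f2 La eta3.
have nb := step_integral_cvg Ss f2 Lb eta3.
have ng := step_mul_cvg Ss g2 ab eta3.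
near ((0 : R)^'+) => e.
have e0 : 0 < e by near: e; exact: nbhs_right_gt.
have := fg _ (test_fun_step Ss (ltW ab) e0).
pose k c x := s (e^-1 * x - e^-1 * c) * e^-1.
have dS c (x : R) : is_derive x 1 (fun y => S (e^-1 * y - e^-1 * c)) (k c x).
  exact: is_derive1_affine (step_derive Ss _).
have -> : derive1n 1 (fun x => S (e^-1 * x - e^-1 * a) - S (e^-1 * x - e^-1 * b)) =
    (fun x => k a x - k b x).
  by apply/funext => x; apply: is_derive1_derive1; exact: is_derive1B.
have fk c : mu.-integrable setT (EFin \o (fun x => f x * k c x)).
  have kM x : `|k c x| <= M * e^-1.
    rewrite normrM [`|e^-1|]gtr0_norm ?invr_gt0 //; apply: ler_wpM2r.
      by rewrite invr_ge0 ltW.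
    by have [] := step_bound Ss (e^-1 * x - e^-1 * c).
  apply: (@integrable_support _ `[c, c + e]%classic) => //.
    move=> x /=; rewrite in_itv /= => /negP; rewrite negb_and -!ltNge => /orP[xc|xc].
      have h : e^-1 * x - e^-1 * c <= 0.
        by rewrite -mulrBr pmulr_rle0 ?invr_gt0 // subr_le0 ltW.
      by rewrite /k; have [_ ->] := step_left Ss h; rewrite mul0r mulr0.
    have h : 1 <= e^-1 * x - e^-1 * c by rewrite -mulrBr ler_pdivlMl // mulr1; lra.
    by rewrite /k; have [_ ->] := step_right Ss h; rewrite mul0r mulr0.
  apply: (integrable_mul_bounded _ _ _ kM) => //; first exact: L2_integrable_itv.
  apply: measurable_funM => //; apply: (measurableT_comp (f := s)).
    by apply: continuous_measurable_fun; exact: step_continuous Ss.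
  apply: measurable_funB => //; exact: measurable_funM.
under eq_Rintegral do rewrite mulrBr.
rewrite RintegralB // expr1 mulN1r => E.
have ea : `|Rintegral mu setT (fun x => f x * (s (e^-1 * x - e^-1 * a) * e^-1)) - f a| <= eta / 3
  by near: e; exact: na.
have ebb : `|Rintegral mu setT (fun x => f x * (s (e^-1 * x - e^-1 * b) * e^-1)) - f b| <= eta / 3
  by near: e; exact: nb.
have eg : `|Rintegral mu setT (fun x => g x *
    (S (e^-1 * x - e^-1 * a) - S (e^-1 * x - e^-1 * b))) - Rintegral mu `[a, b] g| <= eta / 3.
  by near: e; exact: ng.
move: ea ebb eg E; set X := Rintegral _ _ _; set Y := Rintegral _ _ _; set Z := Rintegral _ _ _.
set W := Rintegral _ _ _ => ea ebb eg E.
have -> : f b - f a - W = (X - f a) - (Y - f b) + (Z - W) by lra.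
rewrite (le_trans (ler_normD _ _)) // (le_trans (lerD (ler_normB _ _) (lexx _))) //.
by lra.
Unshelve. all: by end_near. Qed.

End weak_derivative.

(** * Continuous representatives and the Sobolev sup bound *)

Section sobolev_representative.
Context {R : realType}.
Implicit Types (f g h p : R -> R) (a b c x d : R) (D E : nat -> R -> R).
Notation mu := (@lebesgue_measure R).

(** Absolute continuity with derivative [g], in increment form: no base point is singled out and no
    pointwise derivative is required. *)
Definition primitive_of h g :=
  forall a b, a <= b -> h b - h a = Rintegral mu `[a, b] g.

Lemma Rintegral_itv_cat g a b c : a <= b -> b <= c -> L2 g ->
  Rintegral mu `[a, c] g = Rintegral mu `[a, b] g + Rintegral mu `[b, c] g.
Proof.
move=> ab bc g2; have gi := L2_integrable_itv a c g2.
apply/eqP; rewrite addrC -subr_eq Rintegral_itvB ?bnd_simp //; apply/eqP.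
rewrite Rintegral_itv_obnd_cbnd //.
apply: integrableS gi => // x /=; rewrite !in_itv /= => /andP[bx ->].
by rewrite andbT (le_trans ab) // ltW.
Qed.

Lemma L2_has_primitive g : L2 g -> exists h, primitive_of h g.
Proof.
move=> g2; exists (fun x => if 0 <= x then Rintegral mu `[0, x] g else - Rintegral mu `[x, 0] g).
move=> a b ab; have [a0|a0] := leP 0 a.
  by rewrite (le_trans a0 ab) (Rintegral_itv_cat a0 ab g2) addrC addKr.
have [b0|b0] := leP 0 b.
  by rewrite opprK (Rintegral_itv_cat (ltW a0) b0 g2) addrC.
by rewrite opprK (Rintegral_itv_cat ab (ltW b0) g2) addrC addrK.
Qed.

Lemma primitive_continuous h g : L2 g -> primitive_of h g -> continuous h.
Proof.
move=> g2 hg x.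
have x11 : x - 1 <= x + 1 by lra.
have := parameterized_integral_continuous x11 (L2_integrable_itv (x - 1) (x + 1) g2).
move=> /(continuous_within_itvP _ _)[]; first by lra.
move=> + _ _ => /(_ x); rewrite in_itv /= ltrBlDr !ltrDl ltr01 => /(_ isT) cG.
pose K y := h (x - 1) + Rintegral mu `[x - 1, y] g.
have cK : K @ x --> K x.
  by apply: (@cvgD _ _ _ _ _ (cst (h (x - 1)))); [exact: cvg_cst|exact: cG].
have KE y : x - 1 <= y -> K y = h y by move=> xy; rewrite /K -hg // subrKC.
rewrite /continuous_at -KE; last by rewrite lerBlDr lerDl.
apply: (cvg_trans _ cK); apply: near_eq_cvg; near=> y; apply: KE.
by apply: ltW; near: y; apply: lt_nbhsr; rewrite ltrBlDr ltrDl.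
Unshelve. all: by end_near. Qed.

Lemma primitive_lin h1 h2 g1 g2 (c : R) : L2 g1 -> L2 g2 ->
  primitive_of h1 g1 -> primitive_of h2 g2 ->
  primitive_of (fun x => c * h1 x - h2 x) (fun x => c * g1 x - g2 x).
Proof.
move=> g12 g22 hg1 hg2 a b ab.
rewrite RintegralB ?RintegralZl //.
- by rewrite -hg1 // -hg2 //; lra.
- exact: L2_integrable_itv.
- by apply: integrableZ_EFin => //; exact: L2_integrable_itv.
- exact: L2_integrable_itv.
Qed.

Lemma weak_deriv_primitive f g : L2 f -> L2 g -> weak_deriv 1 f g ->
  exists2 h, {ae mu, forall x, f x = h x} & primitive_of h g.
Proof.
move=> f2 g2 fg.
have Lf := lebesgue_differentiation (L2_locally_integrable f2).
(* The free constant of the primitive is fixed at one Lebesgue point [c]; agreement at every other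
   Lebesgue point follows. *)
have [c [_ Lc]] := ae_lebesgue_dense ltr01 Lf.
have [G Gg] := L2_has_primitive g2.
exists (fun x => f c + (G x - G c)); last first.
  by move=> a b ab; rewrite -Gg //; lra.
move: Lf; apply: ae_lebesgueS => x Lx.
have [xc|cx|->] := ltgtP x c; last by rewrite subrr addr0.
  have := weak_deriv_lebesgue_pt f2 g2 fg Lx Lc xc.
  by rewrite -Gg ?ltW //; lra.
have := weak_deriv_lebesgue_pt f2 g2 fg Lc Lx cx.
by rewrite -Gg ?ltW //; lra.
Qed.

Lemma test_fun_derive1 phi : test_fun phi -> test_fun (derive1 phi : R -> R).
Proof.
move=> [phi_d [M phi0]]; split.
  by move=> n x; rewrite -derive1Sn; exact: phi_d.
exists M => x Mx; apply: is_derive1_derive1.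
apply: (@is_derive_near _ (cst 0)).
near=> y; rewrite /= phi0 //; near: y.
have : {for x, continuous (fun y : R => `|y|)} by exact: norm_continuous.
move=> /cvgr_gt; exact.
Unshelve. all: by end_near. Qed.

(** The order [j] identity tested against [phi'] and the order [j + 1] identity tested against [phi]
    have the same left side; the sign [(-1)^j] cancels. *)
Lemma sobolev_weak_deriv1 (k : nat) f D j : sobolev_derivs k f D -> (j < k)%N ->
  weak_deriv 1 (D j) (D j.+1).
Proof.
move=> [_ fD] jk phi tphi.
have [_ /(_ _ (test_fun_derive1 tphi)) Ej] := fD j (ltnW jk).
have [_ /(_ _ tphi)] := fD j.+1 jk.
rewrite derive1Sn Ej exprS -mulrA mulrCA.
by move=> /(mulfI _); rewrite expr1; apply; rewrite signr_eq0.
Qed.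

(** The bound is strict: the top derivative [D k] only serves as the integrand for [E k.-1] and need
    not have a continuous version. *)
Definition sobolev_rep (k : nat) D E := forall j, (j < k)%N ->
  {ae mu, forall x, D j x = E j x} /\ primitive_of (E j) (D j.+1).

Lemma exists_sobolev_rep (k : nat) f D :
  sobolev_derivs k f D -> exists E, sobolev_rep k D E.
Proof.
move=> fD; have [_ DL] := fD.
have /choice[E EP] : forall j, exists h, (j < k)%N ->
    {ae mu, forall x, D j x = h x} /\ primitive_of h (D j.+1).
  move=> j; have [jk|] := boolP (j < k)%N; last by exists 0.
  have [h1 h2] := weak_deriv_primitive (DL j (ltnW jk)).1 (DL j.+1 jk).1
    (sobolev_weak_deriv1 fD jk).
  by exists h1.
by exists E.
Qed.

Lemma sobolev_rep_continuous (k : nat) f D E j : sobolev_derivs k f D ->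
  sobolev_rep k D E -> (j < k)%N -> continuous (E j).
Proof.
move=> [_ fD] DE jk; have [_] := DE j jk; apply: primitive_continuous.
by have [] := fD j.+1 jk.
Qed.

(** [E j] is a primitive of [D j.+1], hence of the continuous [E j.+1], equal to it almost
    everywhere; the classical fundamental theorem then applies. *)
Lemma sobolev_rep_derive (k : nat) f D E j (x : R) : sobolev_derivs k f D ->
  sobolev_rep k D E -> (j.+1 < k)%N -> is_derive x 1 (E j) (E j.+1 x).
Proof.
move=> fD DE jk; have [_ DL] := fD.
have cE := sobolev_rep_continuous fD DE jk.
apply: is_derive_primitive => // a b ab.
have [_ ->//] := DE j (ltnW jk).
have [ae_DE _] := DE j.+1 jk.
have [||_ ->//] := ae_eq_Rintegral _ (L2_integrable_itv a b (DL j.+1 (ltnW jk)).1) _ ae_DE.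
- exact: measurable_itv.
- exact: continuous_measurable_fun.
Qed.

(** A difference at one point would persist on an interval, which must meet the set of full
    measure. *)
Lemma continuous_ae_eq f g : continuous f -> continuous g ->
  {ae mu, forall x, f x = g x} -> f = g.
Proof.
move=> cf cg fg; apply/funext => x; apply: contrapT => /eqP; rewrite -subr_eq0 => neq.
have : {for x, continuous (fun y => `|f y - g y|)}.
  apply: (@continuous_comp _ _ _ (fun y => f y - g y) (fun y : R => `|y|)).
    by apply: cvgB; [exact: cf|exact: cg].
  exact: norm_continuous.
move=> /cvgr_gt /(_ 0); rewrite normr_gt0 => /(_ neq) [e /= e0 he].
have xe : x < x + e by rewrite ltrDl.
have [y [/andP[xy yxe] fgy]] := ae_lebesgue_dense xe fg.
have := he y; rewrite /= ltr0_norm ?subr_lt0 // opprB ltrBlDl => /(_ yxe).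
by rewrite fgy subrr normr0 ltxx.
Qed.

(** Young's inequality [|f| <= d / 2 + f^2 / (2 d)], integrated over an interval of length 1. *)
Lemma L2_norm1_itv f x d : L2 f -> 0 < d ->
  Rintegral mu `[x, x + 1] (fun y => `|f y|) <=
  d / 2 + (2 * d)^-1 * Rintegral mu setT (fun y => f y ^+ 2).
Proof.
move=> f2 d0; have [mf f2i] := f2.
have fi := L2_integrable_itv x (x + 1) f2.
have f2I : mu.-integrable `[x, x + 1] (EFin \o (fun y => f y ^+ 2)).
  exact: (integrableS measurableT).
have ci : mu.-integrable `[x, x + 1] (EFin \o (fun=> d / 2)).
  by apply: continuous_integrable_itv => y; exact: cvg_cst.
apply: (@le_trans _ _ (Rintegral mu `[x, x + 1]
   (fun y => d / 2 + (2 * d)^-1 * f y ^+ 2))).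
  apply: le_Rintegral => //.
  - exact: integrable_norm.
  - by apply: integrableD_EFin => //; exact: integrableZ_EFin.
  - move=> y _; rewrite -[f y ^+ 2]real_normK ?num_real //.
    have : 0 <= (2 * d)^-1 * (`|f y| - d) ^+ 2.
      by rewrite mulr_ge0 ?sqr_ge0 // invr_ge0 mulr_ge0 // ltW.
    have -> : (2 * d)^-1 * (`|f y| - d) ^+ 2 = d / 2 + (2 * d)^-1 * `|f y| ^+ 2 - `|f y|.
      by field; rewrite gt_eqF.
    by rewrite subr_ge0.
rewrite RintegralD //; last exact: integrableZ_EFin.
rewrite [X in _ + X]RintegralZl //.
rewrite Rintegral_cst //= lebesgue_measure_itv /= lte_fin ltrDl ltr01.
rewrite -EFinB /= addrAC subrr add0r mulr1 lerD2l ler_wpM2l //.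
  by rewrite invr_ge0 mulr_ge0 // ltW.
apply: fine_le; [exact: integrable_fin_num|exact: integrable_fin_num|].
apply: ge0_subset_integral => //; first exact: measurable_int f2i.
by move=> y _; rewrite lee_fin sqr_ge0.
Qed.

(** For [y] in [[x, x + 1]], [|h x|] is at most [|h y|] plus the integral of [|g|]. Averaging over
    [y] and applying Young's inequality to both terms gives the bound; [d] stays free so that small
    [L2] norms force a small supremum. *)
Lemma primitive_sup_bound h p g x d : L2 p -> L2 g -> primitive_of h g ->
  {ae mu, forall y, p y = h y} -> 0 < d ->
  `|h x| <= d + (2 * d)^-1 * (Rintegral mu setT (fun y => p y ^+ 2) +
                              Rintegral mu setT (fun y => g y ^+ 2)).
Proof.
move=> p2 g2 hg ph d0.
have ch := primitive_continuous g2 hg.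
have mh : measurable_fun setT h by exact: continuous_measurable_fun.
have gi := L2_integrable_itv x (x + 1) g2.
have hi : mu.-integrable `[x, x + 1] (EFin \o h) by exact: continuous_integrable_itv.
have ci c : mu.-integrable `[x, x + 1] (EFin \o (fun=> c)).
  by apply: continuous_integrable_itv => y; exact: cvg_cst.
have cint c : Rintegral mu `[x, x + 1] (fun=> c) = c.
  rewrite Rintegral_cst //= lebesgue_measure_itv /= lte_fin ltrDl ltr01.
  by rewrite -EFinB /= addrAC subrr add0r mulr1.
set G := Rintegral mu `[x, x + 1] (fun y => `|g y|).
have hx y : `[x, x + 1]%classic y -> `|h x| <= `|h y| + G.
  rewrite /= in_itv /= => /andP[xy yx].
  have -> : h x = h y - (h y - h x) by rewrite opprB addrC subrK.
  rewrite (le_trans (ler_normB _ _)) // lerD2l hg //.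
  apply: le_trans (le_normr_Rintegral _ _) _ => //; first exact: L2_integrable_itv.
  have sub : `[x, y] `<=` `[x, x + 1].
    by move=> z; rewrite /= !in_itv /= => /andP[-> zy]; rewrite (le_trans zy).
  have ng : mu.-integrable `[x, x + 1] (EFin \o (fun y => `|g y|)) by exact: integrable_norm.
  have ng' : mu.-integrable `[x, y] (EFin \o (fun y => `|g y|)) by exact: integrableS ng.
  apply: fine_le; [exact: integrable_fin_num|exact: integrable_fin_num|].
  by apply: ge0_subset_integral => //; exact: measurable_int ng.
have : `|h x| <= Rintegral mu `[x, x + 1] (fun y => `|h y|) + G.
  rewrite -[leLHS]cint -[X in _ <= _ + X]cint -RintegralD //; last exact: integrable_norm.
  apply: le_Rintegral => //; apply: integrableD_EFin => //; exact: integrable_norm.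
have nph : Rintegral mu `[x, x + 1] (fun y => `|h y|) = Rintegral mu `[x, x + 1] (fun y => `|p y|).
  have pn : mu.-integrable `[x, x + 1] (EFin \o (fun y => `|p y|)).
    by apply: integrable_norm; exact: L2_integrable_itv.
  have [|||_ ->//] := ae_eq_Rintegral (g := fun y => `|h y|) _ pn.
  - exact: measurable_itv.
  - exact: measurableT_comp.
  - by move: ph; apply: ae_lebesgueS => y ->.
rewrite nph.
have := L2_norm1_itv x p2 d0; have := L2_norm1_itv x g2 d0; rewrite -/G.
set A := Rintegral mu setT _; set B := Rintegral mu setT _; set P := Rintegral _ _ _.
by rewrite mulrDr; lra.
Qed.

End sobolev_representative.

(** * The Green function of 1 - d^2/dx^2 *)

Section green_function.
Context {R : realType}.
Implicit Types (w : R -> R) (x y a b : R).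
Notation mu := (@lebesgue_measure R).

Lemma continuous_exp_lin (c d : R) : continuous (fun x : R => expR (c * x + d)).
Proof.
move=> x; apply: (@is_derive_continuous _ _ _ (expR (c * x + d) * c)).
exact: is_derive1_affine (is_derive_expR _).
Qed.

Lemma continuousM_fun (f g : R -> R) : continuous f -> continuous g ->
  continuous (fun x => f x * g x).
Proof. by move=> cf cg x; apply: (@cvgM _ _ _ _ f g); [exact: cf|exact: cg]. Qed.

Lemma continuous_expM (c : R) : continuous (fun x : R => expR (c * x)).
Proof.
by move=> x; have := @continuous_exp_lin c 0 x; under eq_fun do rewrite addr0.
Qed.

Lemma integrable_exp_half w (c : R) (i : interval R) (M : R) : continuous w ->
  mu.-integrable setT (EFin \o w) -> (forall y, y \in i -> expR (c * y) <= M) ->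
  mu.-integrable [set` i] (EFin \o (fun y => expR (c * y) * w y)).
Proof.
move=> cw wi eM.
have iM : mu.-integrable [set` i] (EFin \o (fun y => M * w y)).
  by apply: integrableZ_EFin => //; exact: integrableS wi.
apply: le_integrable iM => //.
  apply/measurable_EFinP; apply: measurable_funTS; apply: continuous_measurable_fun.
  apply: continuousM_fun => //; exact: continuous_expM.
move=> y /= yi; rewrite lee_fin !normrM ler_wpM2r //.
by rewrite ger0_norm ?expR_ge0 // (le_trans (eM y yi)) // ler_norm.
Qed.

(** Cutting the kernel at [y = x] gives [p = (e^-x A + e^x B) / 2], with [A] and [B] exponentially
    weighted integrals over the left and right half-lines, both differentiable in [x]. *)
Lemma green_derive w : continuous w -> mu.-integrable setT (EFin \o w) ->
  exists q : R -> R, forall x : R,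
    is_derive x 1 (fun x => Rintegral mu setT (fun y => (2^-1 * expR (- `|x - y|)) * w y)) (q x)
    /\ is_derive x 1 q
       (Rintegral mu setT (fun y => (2^-1 * expR (- `|x - y|)) * w y) - w x).
Proof.
move=> cw wi.
pose A x := Rintegral mu `]-oo, x] (fun y => expR (1 * y) * w y).
pose B x := Rintegral mu `[x, +oo[ (fun y => expR (- 1 * y) * w y).
have Ai x : mu.-integrable `]-oo, x] (EFin \o (fun y => expR (1 * y) * w y)).
  apply: (integrable_exp_half (M := expR x)) => // y.
  by rewrite in_itv /= mul1r ler_expR.
have Bi x : mu.-integrable `[x, +oo[ (EFin \o (fun y => expR (- 1 * y) * w y)).
  apply: (integrable_exp_half (M := expR (- x))) => // y.
  by rewrite in_itv /= andbT mulN1r ler_expR lerN2.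
have ce c : continuous (fun y => expR (c * y) * w y).
  apply: continuousM_fun => //; exact: continuous_expM.
have AE a b : a <= b -> A b - A a = Rintegral mu `[a, b] (fun y => expR (1 * y) * w y).
  move=> ab; rewrite /A Rintegral_itvB ?bnd_simp // Rintegral_itv_obnd_cbnd //.
  by apply: integrableS (Ai b) => // y /=; rewrite !in_itv /= => /andP[].
(* The half-line of [B] shrinks as its endpoint grows, so [- B] is the primitive. *)
have BE a b : a <= b -> - B b - - B a = Rintegral mu `[a, b] (fun y => expR (- 1 * y) * w y).
  move=> ab; have := Rintegral_itvB (x := b) (Bi a); rewrite !bnd_simp => /(_ ab isT).
  rewrite Rintegral_itv_obnd_cbnd; last first.
    apply: integrableS (Bi b) => // y /=; rewrite !in_itv /= !andbT; exact: ltW.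
  by rewrite /B => <-; rewrite opprK addrC subKr.
have dA (x : R) : is_derive x 1 A (expR (1 * x) * w x).
  exact: (@is_derive_primitive _ A _ x (ce 1) AE).
have dB (x : R) : is_derive x 1 B (- (expR (- 1 * x) * w x)).
  have := is_derive1N (@is_derive_primitive _ (fun x => - B x) _ x (ce (- 1)) BE).
  by under eq_fun do rewrite opprK.
have dE c (x : R) : is_derive x 1 (fun y : R => expR (c * y)) (expR (c * x) * c).
  have := is_derive1_affine (is_derive_expR (c * x + 0)).
  by under eq_fun do rewrite addr0; rewrite addr0.
pose p x := 2^-1 * (expR (- 1 * x) * A x + expR (1 * x) * B x).
have pE : (fun x => Rintegral mu setT (fun y => (2^-1 * expR (- `|x - y|)) * w y)) = p.
  apply/funext => x.
  have ki : mu.-integrable setT (EFin \o (fun y => w y * (2^-1 * expR (- `|x - y|)))).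
    apply: (integrable_mul_bounded (M := 1)) => //.
      apply: measurable_funM => //; apply: measurableT_comp => //.
      apply: measurableT_comp => //; apply: measurableT_comp => //.
      exact: measurable_funB.
    move=> y; rewrite ger0_norm ?mulr_ge0 ?expR_ge0 //.
    have : expR (- `|x - y|) <= 1 by rewrite -expR0 ler_expR oppr_le0.
    lra.
  have {}ki : mu.-integrable `]-oo, +oo[ (EFin \o (fun y => (2^-1 * expR (- `|x - y|)) * w y)).
    rewrite set_itvNyy; apply: eq_integrable ki => // y _ /=.
    by rewrite [w y * _]mulrC.
  have := Rintegral_itvB (x := x) ki; rewrite !bnd_simp => /(_ isT isT).
  rewrite set_itvNyy => /eqP; rewrite subr_eq addrC => /eqP ->.
  rewrite Rintegral_itv_obnd_cbnd; last exact: integrableS ki.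
  rewrite /p mulrDr; congr (_ + _).
    rewrite mulrA -RintegralZl //; apply: eq_Rintegral => y.
    rewrite inE /= in_itv /= => yx; rewrite ger0_norm ?subr_ge0 //.
    have -> : expR (- (x - y)) = expR (- 1 * x) * expR (1 * y).
      by rewrite -expRD mulN1r mul1r opprB addrC.
    by ring.
  rewrite mulrA -RintegralZl //; apply: eq_Rintegral => y.
  rewrite inE /= in_itv /= andbT => yx; rewrite ler0_norm ?subr_le0 // opprK.
  have -> : expR (x - y) = expR (1 * x) * expR (- 1 * y).
    by rewrite -expRD mulN1r mul1r.
  by ring.
(* In [p'] the terms from [A'] and [B'] cancel and leave this function; in its derivative they add
   up to [- w]. *)
rewrite pE; exists (fun x => 2^-1 * (expR (1 * x) * B x - expR (- 1 * x) * A x)) => x.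
have dm := is_derive1M (dE (- 1) x) (dA x); have dp := is_derive1M (dE 1 x) (dB x).
have eee : expR (- 1 * x) * expR (1 * x) = 1.
  by rewrite -expRD mulN1r mul1r addrC subrr expR0.
split.
  apply: (is_derive1_eq (is_derive1Z 2^-1 (is_derive1D dm dp))).
  by rewrite !mul1r !mulN1r; ring.
apply: (is_derive1_eq (is_derive1Z 2^-1 (is_derive1B dp dm))).
transitivity (p x - expR (- 1 * x) * expR (1 * x) * w x); last first.
  by rewrite eee mul1r; congr (_ - _); exact: esym (congr1 (fun f : R -> R => f x) pE).
by rewrite /p; field.
Qed.

End green_function.

(** * Convex sets and strips in the plane *)

Section plane_topology.
Context {R : realType}.
Implicit Types (C : set (R * R)) (p q : R * R).

Definition segment_point p q (s : R) : R * R :=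
  (p.1 + s * (q.1 - p.1), p.2 + s * (q.2 - p.2)).

Definition segment_convex C := forall p q s,
  C p -> C q -> 0 <= s <= 1 -> C (segment_point p q s).

(** A ball of the product is a product of intervals, so convexity is checked in each coordinate. *)
Lemma ball_segment_convex p (r : R) : segment_convex (ball p r).
Proof.
have conv (c a b s : R) : `|c - a| < r -> `|c - b| < r -> 0 <= s <= 1 ->
    `|c - (a + s * (b - a))| < r.
  move=> ca cb /andP[s0 s1].
  have -> : c - (a + s * (b - a)) = (1 - s) * (c - a) + s * (c - b) by ring.
  rewrite (le_lt_trans (ler_normD _ _)) // !normrM.
  rewrite (ger0_norm s0) (@ger0_norm _ (1 - s)) ?subr_ge0 //.
  (* Strictness comes from the term with factor [s], so [s = 0] is treated apart. *)
  have [->|sn0] := eqVneq s 0; first by rewrite subr0 mul1r mul0r addr0.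
  have s_gt0 : 0 < s by rewrite lt_neqAle eq_sym sn0.
  have h1 : (1 - s) * `|c - a| <= (1 - s) * r by rewrite ler_wpM2l ?subr_ge0 // ltW.
  have h2 : s * `|c - b| < s * r by rewrite ltr_pM2l.
  have -> : r = (1 - s) * r + s * r by ring.
  exact: ler_ltD.
move=> q1 q2 s [/= h11 h12] [/= h21 h22] s01.
by split; rewrite /ball /=; apply: conv.
Qed.

Lemma cvg_segment_point {T : Type} (F : set_system T) (f g : T -> R * R) (h : T -> R)
    (p q : R * R) (s : R) : Filter F ->
  f @ F --> p -> g @ F --> q -> h @ F --> s ->
  (fun x => segment_point (f x) (g x) (h x)) @ F --> segment_point p q s.
Proof.
move=> FF fp gq hs.
have f1 : (fst \o f) @ F --> p.1 by apply: (cvg_comp _ _ fp); exact: cvg_fst.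
have f2 : (snd \o f) @ F --> p.2 by apply: (cvg_comp _ _ fp); exact: cvg_snd.
have g1 : (fst \o g) @ F --> q.1 by apply: (cvg_comp _ _ gq); exact: cvg_fst.
have g2 : (snd \o g) @ F --> q.2 by apply: (cvg_comp _ _ gq); exact: cvg_snd.
have lin (a b c : R) (u v w : T -> R) : u @ F --> a -> v @ F --> b -> w @ F --> c ->
    (fun x => u x + w x * (v x - u x)) @ F --> a + c * (b - a).
  by move=> ua vb wc; apply: cvgD => //; apply: cvgM => //; exact: cvgB.
exact: (cvg_pair (lin _ _ _ _ _ _ f1 g1 hs) (lin _ _ _ _ _ _ f2 g2 hs)).
Qed.

Lemma near_within (T : topologicalType) (A P : set T) (x : T) :
  (\forall y \near x, A y -> P y) -> \forall y \near within A (nbhs x), P y.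
Proof. by []. Qed.

Lemma convex_simply_connected C : segment_convex C -> simply_connected C.
Proof.
move=> convC; split.
  move=> p q Cp Cq; exists (segment_point p q); split.
  - apply: continuous_subspaceT => s.
    by apply: cvg_segment_point; [exact: cvg_cst|exact: cvg_cst|exact: cvg_id].
  - by rewrite /segment_point !mul0r !addr0 -surjective_pairing.
  - by rewrite /segment_point !mul1r !subrKC -surjective_pairing.
  - by move=> _ [s /= s01 <-]; apply: convC => //; rewrite in_itv /= in s01.
move=> g cg g01 gC.
have gC' s : s \in `[0, 1] -> C (g s) by move=> s01; apply: gC; exists s.
have in0 : (0 : R) \in `[0, 1] by rewrite in_itv /= lexx ler01.
(* The straight-line homotopy contracts the loop to its base point. *)
exists (fun p => segment_point (g p.1) (g 0) p.2); split.
- apply/subspace_continuousP => p [p1 p2]; apply: cvg_segment_point.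
  + have /subspace_continuousP /(_ _ p1) gp := cg.
    (* The loop is continuous only relative to [[0, 1]], so the projection has to respect that
       restriction. *)
    have fst_p : fst @ within (@unit_sq R) (nbhs p) --> within `[0, 1] (nbhs p.1).
      move=> P P01; change (\forall z \near p, @unit_sq R z -> P z.1).
      have : \forall z \near p, z.1 \in `[0, 1] -> P z.1.
        by have /(_ _ P01) : fst @ nbhs p --> p.1 by exact: cvg_fst.
      by apply: filterS => z h [z1 _]; exact: h.
    exact: (cvg_comp _ _ fst_p gp).
  + exact: cvg_cst.
  + by apply: cvg_within_filter; exact: cvg_snd.
- move=> s s01 /=; rewrite /segment_point !mul0r !addr0 !mul1r !subrKC.
  by rewrite -!surjective_pairing.
- move=> r r01 /=; rewrite /segment_point -g01 !subrr !mulr0 !addr0.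
  by rewrite -!surjective_pairing.
- move=> _ [p [p1 p2] <-]; apply: convC; [exact: gC'|exact: gC'|].
  by rewrite in_itv /= in p2.
Unshelve. all: by end_near. Qed.

(** Joint continuity by splitting the increment: continuity in [x] at the fixed time [t0], then
    continuity in time uniform in [x]. *)
Lemma strip_continuous (T : \bar R) (G f : R -> R -> R) :
  (forall t, tI T t -> continuous (G t)) ->
  (forall t0 eta, tI T t0 -> 0 < eta ->
     \forall t \near within (tI T) (nbhs t0), forall x, `|G t x - G t0 x| <= eta) ->
  (forall x t, tI T t -> f x t = G t x) ->
  {within strip T, continuous (fun p : R * R => f p.1 p.2)}.
Proof.
move=> cG uG fG; apply/subspace_continuousP => -[x0 t0] /= Tt0.
apply/cvgrPdist_le => eta eta0.
have eta2 : 0 < eta / 2 by rewrite divr_gt0.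
have ex : \forall x \near x0, `|G t0 x0 - G t0 x| <= eta / 2.
  by have /cvgrPdist_le := cG t0 Tt0 x0; apply.
have et : \forall t \near t0, tI T t -> forall x, `|G t x - G t0 x| <= eta / 2.
  exact: uG Tt0 eta2.
apply: near_within.
exists ([set x | `|G t0 x0 - G t0 x| <= eta / 2],
        [set t | tI T t -> forall x, `|G t x - G t0 x| <= eta / 2]) => //.
move=> [x t] [/= hx ht] Tt; rewrite /strip /= in Tt.
change (`|f x0 t0 - f x t| <= eta); rewrite !fG //.
have -> : G t0 x0 - G t x = (G t0 x0 - G t0 x) - (G t x - G t0 x) by ring.
by rewrite (le_trans (ler_normB _ _)) // [eta]splitr lerD // ht.
Qed.

End plane_topology.

(** * Existence interval and one-sided time derivatives *)

Section time_interval.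
Context {R : realType}.
Implicit Types (T : \bar R) (t : R).

Lemma tI_near T t : 0 < t -> tI T t -> \forall s \near t, tI T s.
Proof.
move=> t0 [_ tT].
have sT : \forall s \near t, (s%:E < T)%E.
  case: T tT => [r| |] //=; last by move=> _; near=> s; rewrite ltry.
  by rewrite lte_fin => tr; near=> s; rewrite lte_fin; near: s; exact: lt_nbhsl.
near=> s; split; last by near: s; exact: sT.
by apply: ltW; near: s; exact: lt_nbhsr.
Unshelve. all: by end_near. Qed.

Lemma tI_right0 T : (0 < T)%E -> \forall t \near (0 : R)^'+, tI T t.
Proof.
move=> T0.
have sT : \forall s \near (0 : R)^'+, (s%:E < T)%E.
  case: T T0 => [r| |] //=; last by move=> _; near=> s; rewrite ltry.
  by rewrite lte_fin => r0; near=> s; rewrite lte_fin; near: s; exact: nbhs_right_lt.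
near=> s; split; last by near: s; exact: sT.
by apply: ltW; near: s; exact: nbhs_right_gt.
Unshelve. all: by end_near. Qed.

Lemma quotient_cvg_tderiv T (f : R -> R -> R) x t l : tI T t ->
  (fun s => (s - t)^-1 * (f x s - f x t)) @ within [set s | tI T s /\ s != t] (nbhs t) --> l ->
  is_tderiv T f x t l.
Proof.
move=> Tt /cvgrPdist_le h; apply/cvgrPdist_le => eta eta0.
have [d /= d0 dP] := h eta eta0.
apply: near_within; exists d => // k; rewrite /= sub0r normrN => kd [Tk k0].
have := dP (t + k); rewrite /= opprD addNKr normrN => /(_ kd).
rewrite -subr_eq0 addrAC subrr add0r; exact.
Qed.

(** At a positive time [tI T] is a neighbourhood, so the restricted limit becomes an ordinary
    two-sided derivative. *)
Lemma quotient_cvg_is_derive T (f : R -> R) (t l : R) : 0 < t -> tI T t ->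
  (fun s => (s - t)^-1 * (f s - f t)) @ within [set s | tI T s /\ s != t] (nbhs t) --> l ->
  is_derive t 1 f l.
Proof.
move=> t0 Tt /cvgrPdist_le h.
have hl : (fun h : R => h^-1 *: (f (h *: 1 + t) - f t)) @ 0^' --> l.
  apply/cvgrPdist_le => eta eta0.
  have [d /= d0 dP] := h eta eta0.
  have [d' /= d'0 d'P] := tI_near t0 Tt.
  near=> k.
  have k0 : k != 0 by near: k; exact: nbhs_dnbhs_neq.
  have kd : `|k| < d by near: k; exact: dnbhs0_lt.
  have kd' : `|k| < d' by near: k; exact: dnbhs0_lt.
  rewrite /GRing.scale /= mulr1 [k + t]addrC.
  have Tk : tI T (t + k) by apply: d'P; rewrite /= opprD addNKr normrN.
  have := dP (t + k); rewrite /= opprD addNKr normrN => /(_ kd).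
  by rewrite -subr_eq0 addrAC subrr add0r; apply.
by split; [exact: cvgP hl | exact: cvg_lim hl].
Unshelve. all: by end_near. Qed.

End time_interval.

(** * Classical regularity of solutions *)

Section uniform_estimates.
Context {R : realType}.
Implicit Types (p g h f : R -> R) (T : \bar R) (D V : nat -> R -> R -> R)
  (E W : R -> nat -> R -> R).
Notation mu := (@lebesgue_measure R).

(** The hypotheses of [primitive_sup_bound] in one bundle, stable under the combinations that occur
    in differences and difference quotients. *)
Definition h1_rep p g h :=
  [/\ L2 p, L2 g, {ae mu, forall x, p x = h x} & primitive_of h g].

Lemma h1_repZB (c : R) p1 g1 h1 p2 g2 h2 : h1_rep p1 g1 h1 -> h1_rep p2 g2 h2 ->
  h1_rep (fun x => c * p1 x - p2 x) (fun x => c * g1 x - g2 x)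
         (fun x => c * h1 x - h2 x).
Proof.
move=> [p12 g12 ph1 hg1] [p22 g22 ph2 hg2]; split.
- by apply: L2B => //; exact: L2Z.
- by apply: L2B => //; exact: L2Z.
- by move: ph1 ph2; apply: ae_lebesgueS2 => x -> ->.
- exact: primitive_lin.
Qed.

Lemma h1_repB p1 g1 h1 p2 g2 h2 : h1_rep p1 g1 h1 -> h1_rep p2 g2 h2 ->
  h1_rep (fun x => p1 x - p2 x) (fun x => g1 x - g2 x) (fun x => h1 x - h2 x).
Proof.
move=> r1 r2; have := h1_repZB 1 r1 r2.
have e (a b : R -> R) : (fun x => 1 * a x - b x) = (fun x => a x - b x).
  by apply/funext => x; rewrite mul1r.
by rewrite !e.
Qed.

Lemma h1_rep_small (F : set_system R) (p g h : R -> R -> R) : Filter F ->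
  (\forall t \near F, h1_rep (p t) (g t) (h t)) ->
  (fun t => Rintegral mu setT (fun x => p t x ^+ 2)) @ F --> (0 : R) ->
  (fun t => Rintegral mu setT (fun x => g t x ^+ 2)) @ F --> (0 : R) ->
  forall eta, 0 < eta -> \forall t \near F, forall x, `|h t x| <= eta.
Proof.
move=> FF rep p0 g0 eta eta0.
(* With [d = eta / 2] in the sup bound, two squared norms of at most [eta^2 / 4] add up to exactly
   [eta]. *)
have e4 : 0 < eta ^+ 2 / 4 by rewrite divr_gt0 // exprn_gt0.
have np : \forall t \near F, `|Rintegral mu setT (fun x => p t x ^+ 2)| <= eta ^+ 2 / 4.
  by move/cvgr0Pnorm_le : p0; exact.
have ng : \forall t \near F, `|Rintegral mu setT (fun x => g t x ^+ 2)| <= eta ^+ 2 / 4.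
  by move/cvgr0Pnorm_le : g0; exact.
near=> t => x.
have [p2 g2 ph hg] : h1_rep (p t) (g t) (h t) by near: t; exact: rep.
have pt : `|Rintegral mu setT (fun x => p t x ^+ 2)| <= eta ^+ 2 / 4 by near: t; exact: np.
have gt : `|Rintegral mu setT (fun x => g t x ^+ 2)| <= eta ^+ 2 / 4 by near: t; exact: ng.
have eta2 : 0 < eta / 2 by rewrite divr_gt0.
apply: le_trans (primitive_sup_bound x p2 g2 hg ph eta2) _.
have E : eta / 2 + (2 * (eta / 2))^-1 * (eta ^+ 2 / 4 + eta ^+ 2 / 4) = eta.
  by field; rewrite gt_eqF.
rewrite -[leRHS]E lerD2l; apply: ler_wpM2l.
  by rewrite invr_ge0 mulr_ge0 // ltW.
by rewrite lerD // (le_trans (ler_norm _)).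
Unshelve. all: by end_near. Qed.

Lemma exists_sobolev_rep_family T (k : nat) (f : R -> R -> R) D :
  (forall t, tI T t -> sobolev_derivs k (f t) (D ^~ t)) ->
  exists E, forall t, tI T t -> sobolev_rep k (D ^~ t) (E t).
Proof.
move=> fD.
have /choice[E EP] : forall t, exists e, tI T t -> sobolev_rep k (D ^~ t) e.
  move=> t; have [Tt|nTt] := pselect (tI T t); last by exists (fun _ => 0).
  by have [e ee] := exists_sobolev_rep (fD t Tt); exists e.
by exists E.
Qed.

Lemma sobolev_h1_rep (k : nat) f (D E : nat -> R -> R) j :
  sobolev_derivs k f D -> sobolev_rep k D E -> (j < k)%N ->
  h1_rep (D j) (D j.+1) (E j).
Proof.
move=> [_ fD] DE jk; have [? ?] := DE j jk.
by split => //; [have [] := fD j (ltnW jk)|have [] := fD j.+1 jk].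
Qed.

(** Uniform convergence costs one derivative: it uses the [L2] convergence of orders [j] and
    [j + 1], hence [j < k]. *)
Lemma h1_rep_unif_continuous T (k : nat) (f : R -> R -> R) D E j t0 eta :
  (forall t, tI T t -> sobolev_derivs k (f t) (D ^~ t)) ->
  (forall t, tI T t -> sobolev_rep k (D ^~ t) (E t)) ->
  (forall j t0, (j <= k)%N -> tI T t0 ->
     (fun t => sq_dist (D j t) (D j t0)) @ within (tI T) (nbhs t0) --> (0 : R)) ->
  (j < k)%N -> tI T t0 -> 0 < eta ->
  \forall t \near within (tI T) (nbhs t0), forall x, `|E t j x - E t0 j x| <= eta.
Proof.
move=> fD DE cD jk Tt0.
apply: (h1_rep_small (p := fun t x => D j t x - D j t0 x)
  (g := fun t x => D j.+1 t x - D j.+1 t0 x) (h := fun t x => E t j x - E t0 j x)).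
- near=> t; have Tt : tI T t by near: t; exact: withinT.
  by apply: h1_repB; apply: sobolev_h1_rep (fD _ _) (DE _ _) jk.
- exact: cD (ltnW jk) Tt0.
- exact: cD jk Tt0.
Unshelve. all: by end_near. Qed.

(** The same sup bound, applied to the difference quotient minus its limit; the convergence obtained
    is even uniform in [x]. *)
Lemma h1_rep_quotient_cvg T (k l : nat) (f v : R -> R -> R) D V E W j t0 x :
  (forall t, tI T t -> sobolev_derivs k (f t) (D ^~ t)) ->
  (forall t, tI T t -> sobolev_rep k (D ^~ t) (E t)) ->
  (forall t, tI T t -> sobolev_derivs l (v t) (V ^~ t)) ->
  (forall t, tI T t -> sobolev_rep l (V ^~ t) (W t)) ->
  (forall j t0, (j <= l)%N -> tI T t0 ->
     (fun t => sq_dist (fun x => (t - t0)^-1 * (D j t x - D j t0 x)) (V j t0))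
       @ within [set t | tI T t /\ t != t0] (nbhs t0) --> (0 : R)) ->
  (j < k)%N -> (j < l)%N -> tI T t0 ->
  (fun t => (t - t0)^-1 * (E t j x - E t0 j x))
    @ within [set t | tI T t /\ t != t0] (nbhs t0) --> W t0 j x.
Proof.
move=> fD DE vV VW cD jk jl Tt0; apply/cvgrPdist_le => eta eta0.
have : \forall t \near within [set t | tI T t /\ t != t0] (nbhs t0),
    forall x, `|(t - t0)^-1 * (E t j x - E t0 j x) - W t0 j x| <= eta.
  apply: (h1_rep_small (p := fun t x => (t - t0)^-1 * (D j t x - D j t0 x) - V j t0 x)
    (g := fun t x => (t - t0)^-1 * (D j.+1 t x - D j.+1 t0 x) - V j.+1 t0 x)
    (h := fun t x => (t - t0)^-1 * (E t j x - E t0 j x) - W t0 j x)) => //.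
  - near=> t; have [Tt _] : tI T t /\ t != t0 by near: t; exact: withinT.
    apply: h1_repZB; last exact: sobolev_h1_rep (vV _ Tt0) (VW _ Tt0) jl.
    by apply: h1_repB; apply: sobolev_h1_rep (fD _ _) (DE _ _) jk.
  - exact: cD (ltnW jl) Tt0.
  - exact: cD jl Tt0.
by apply: filterS => t /(_ x); rewrite distrC.
Unshelve. all: by end_near. Qed.

End uniform_estimates.

(** * From the nonlocal equation to a classical solution *)

Section classical.
Context {R : realType}.
Implicit Types (f : R -> R) (T : \bar R) (E W : R -> nat -> R -> R).
Notation mu := (@lebesgue_measure R).

Lemma is_derive1_unique f (x a b : R) : is_derive x 1 f a -> is_derive x 1 f b -> a = b.
Proof. by move=> [_ <-] [_ <-]. Qed.

(** [E t j] and [W t j] are continuous versions of the [j]-th x-derivatives of [u] and [u_t] at time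
    [t]: [H^4] yields four of them and [H^3] three. [cs_eq] is the local form of the equation. *)
Record classical_solution T (u : R -> R -> R) E W : Prop := ClassicalSolution {
  cs_val : forall t x, tI T t -> u x t = E t 0 x ;
  cs_dE : forall t j (x : R), tI T t -> (j < 3)%N -> is_derive x 1 (E t j) (E t j.+1 x) ;
  cs_dW : forall t j (x : R), tI T t -> (j < 2)%N -> is_derive x 1 (W t j) (W t j.+1 x) ;
  cs_cE : forall t j, tI T t -> (j < 4)%N -> continuous (E t j) ;
  cs_cW : forall t j, tI T t -> (j < 3)%N -> continuous (W t j) ;
  cs_uE : forall j t eta, (j < 4)%N -> tI T t -> 0 < eta ->
    \forall s \near within (tI T) (nbhs t), forall x, `|E s j x - E t j x| <= eta ;
  cs_uW : forall j t eta, (j < 3)%N -> tI T t -> 0 < eta ->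
    \forall s \near within (tI T) (nbhs t), forall x, `|W s j x - W t j x| <= eta ;
  cs_quot : forall j t x, (j < 3)%N -> tI T t ->
    (fun s => (s - t)^-1 * (E s j x - E t j x))
      @ within [set s | tI T s /\ s != t] (nbhs t) --> W t j x ;
  cs_eq : forall t x, tI T t -> W t 0 x - W t 2 x =
    - 4 * E t 0 x * E t 1 x + 3 * E t 1 x * E t 2 x + E t 0 x * E t 3 x ;
  cs_L2 : forall t, tI T t -> L2 (E t 0) ;
  cs_bound : forall t, tI T t -> exists K, forall x, `|E t 0 x| <= K /\ `|E t 1 x| <= K }.

Lemma h1_rep_bounded (p g h : R -> R) : h1_rep p g h -> exists K, forall x, `|h x| <= K.
Proof.
move=> [p2 g2 ph hg].
by eexists => x; exact: (primitive_sup_bound x p2 g2 hg ph ltr01).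
Qed.

(* Applying [1 - d^2/dx^2] to the nonlocal equation [v + e e' = - (G * w)'],
   where [G * w - (G * w)'' = w] and [w = (3/2) e^2]. *)
Lemma local_form (e0 e1 e2 e3 v0 v1 v2 q : R -> R) (p : R -> R) :
  (forall x : R, is_derive x 1 e0 (e1 x)) -> (forall x : R, is_derive x 1 e1 (e2 x)) ->
  (forall x : R, is_derive x 1 e2 (e3 x)) -> (forall x : R, is_derive x 1 v0 (v1 x)) ->
  (forall x : R, is_derive x 1 v1 (v2 x)) -> (forall x : R, is_derive x 1 p (q x)) ->
  (forall x : R, is_derive x 1 q (p x - 3 / 2 * e0 x ^+ 2)) ->
  (forall x, v0 x + e0 x * e1 x = - q x) ->
  forall x, v0 x - v2 x = - 4 * e0 x * e1 x + 3 * e1 x * e2 x + e0 x * e3 x.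
Proof.
move=> d0 d1 d2 dv0 dv1 dp dq eq x.
have qE : q = (fun x => - (v0 x + e0 x * e1 x)).
  by apply/funext => y; rewrite eq opprK.
have pE : p = (fun x => 3 / 2 * e0 x ^+ 2 - (v1 x + (e0 x * e2 x + e1 x * e1 x))).
  apply/funext => y; have := dq y; rewrite qE => dq'.
  have := is_derive1_unique dq'
    (is_derive1N (is_derive1D (dv0 y) (is_derive1M (d0 y) (d1 y)))).
  by rewrite /=; lra.
have := dp x; rewrite pE => dp'.
have := is_derive1_unique dp'
  (is_derive1B (is_derive1Z (3 / 2) (is_derive1X 2 (d0 x)))
    (is_derive1D (dv1 x) (is_derive1D (is_derive1M (d0 x) (d2 x))
                                      (is_derive1M (d1 x) (d1 x))))).
rewrite qE expr1 => h.
by apply/eqP; rewrite -subr_eq0; move/eqP: h; rewrite -subr_eq0 => /eqP h; apply/eqP;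
  rewrite -[LHS]opprK -[RHS]oppr0 -h; congr (- _); field.
Qed.

Lemma solution_classical (u0 : R -> R) T u : is_solution u0 T u ->
  (forall t, tI T t -> continuous (fun x => u x t)) ->
  exists E W, classical_solution T u E W.
Proof.
move=> [_ [D [V [fD [fV [cD [cV [qD [eqn _]]]]]]]]] cu.
have [E DE] := exists_sobolev_rep_family fD.
have [W VW] := exists_sobolev_rep_family fV.
have D0 t : tI T t -> D 0%N t = (fun x => u x t) by move=> Tt; have [-> _] := fD t Tt.
have cE t j : tI T t -> (j < 4)%N -> continuous (E t j).
  by move=> Tt; exact: sobolev_rep_continuous (fD _ Tt) (DE _ Tt).
have cW t j : tI T t -> (j < 3)%N -> continuous (W t j).
  by move=> Tt; exact: sobolev_rep_continuous (fV _ Tt) (VW _ Tt).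
have dE t j (x : R) : tI T t -> (j < 3)%N -> is_derive x 1 (E t j) (E t j.+1 x).
  by move=> Tt j3; exact: sobolev_rep_derive (fD _ Tt) (DE _ Tt) _.
have dW t j (x : R) : tI T t -> (j < 2)%N -> is_derive x 1 (W t j) (W t j.+1 x).
  by move=> Tt j3; exact: sobolev_rep_derive (fV _ Tt) (VW _ Tt) _.
(* Continuity of [u] in [x] upgrades almost everywhere equality with the representative to
   equality. *)
have uE t : tI T t -> (fun x => u x t) = E t 0%N.
  move=> Tt; apply: continuous_ae_eq; [exact: cu|exact: cE|].
  by have [] := DE t Tt 0%N isT; rewrite D0.
have L2u t : tI T t -> L2 (E t 0%N).
  by move=> Tt; rewrite -uE // -D0 //; have [_ /(_ 0%N isT)[]] := fD t Tt.
have rep t j : tI T t -> (j < 4)%N -> h1_rep (D j t) (D j.+1 t) (E t j).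
  by move=> Tt; exact: sobolev_h1_rep (fD _ Tt) (DE _ Tt).
exists E, W; split => //.
- by move=> t x Tt; rewrite -uE.
- by move=> j t eta j4 Tt eta0; exact: h1_rep_unif_continuous fD DE cD j4 Tt eta0.
- by move=> j t eta j3 Tt eta0; exact: h1_rep_unif_continuous fV VW cV j3 Tt eta0.
- move=> j t x j3 Tt.
  exact: h1_rep_quotient_cvg fD DE fV VW qD (ltnW j3) j3 Tt.
- move=> t x Tt.
  have cw : continuous (fun y => 3 / 2 * u y t ^+ 2).
    have -> : (fun y => 3 / 2 * u y t ^+ 2) = (fun y => cst (3 / 2) y * (u y t * u y t)).
      by apply/funext => y; rewrite expr2.
    apply: continuousM_fun; first by move=> y; exact: cvg_cst.
    by apply: continuousM_fun; exact: cu.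
  have wi : mu.-integrable setT (EFin \o (fun y => 3 / 2 * u y t ^+ 2)).
    apply: integrableZ_EFin => //.
    by have [_] := L2u t Tt; rewrite -uE.
  have [q qP] := green_derive cw wi.
  have eu y : u y t = E t 0%N y by rewrite -uE.
  apply: (@local_form (E t 0%N) (E t 1%N) (E t 2%N) (E t 3%N) (W t 0%N) (W t 1%N) (W t 2%N)
    q (nonlocal u t)).
  + by move=> y; exact: dE.
  + by move=> y; exact: dE.
  + by move=> y; exact: dE.
  + by move=> y; exact: dW.
  + by move=> y; exact: dW.
  + by move=> y; have [] := qP y.
  + by move=> y; rewrite -eu; have [_] := qP y.
  (* The equation is known almost everywhere; both sides are continuous, so it holds at every
     point. *)
  + move=> y; pose L z := W t 0%N z + E t 0%N z * E t 1%N z; pose M z := - q z.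
    suff : L = M by move=> /(congr1 (fun f : R -> R => f y)).
    apply: continuous_ae_eq.
    * move=> z; apply: (@cvgD _ _ _ _ _ (W t 0%N) (fun z => E t 0%N z * E t 1%N z)).
        exact: cW.
      by apply: continuousM_fun; exact: cE.
    * by move=> z; apply: is_derive_continuous (is_derive1N (qP z).2).
    * have [V0 _] := VW t Tt 0%N isT; have [D1 _] := DE t Tt 1%N isT.
      have VD := ae_lebesgueS2 (S := fun z => V 0%N t z = W t 0%N z /\ D 1%N t z = E t 1%N z)
        (fun z a b => conj a b) V0 D1.
      move: (eqn t Tt) VD; apply: ae_lebesgueS2 => z eqz [Vz Dz].
      rewrite /L /M -Vz -Dz -eu eqz; congr (- _).
      by apply: is_derive1_derive1; have [] := qP z.
- move=> t Tt; have [K0 h0] := h1_rep_bounded (rep t 0%N Tt isT).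
  have [K1 h1] := h1_rep_bounded (rep t 1%N Tt isT).
  by exists (Num.max K0 K1) => x; rewrite !le_max h0 h1 orbT.
Qed.

Lemma derive1n_tower (f : R -> R) (G : nat -> R -> R) (n : nat) : f = G 0%N ->
  (forall j (x : R), (j < n)%N -> is_derive x 1 (G j) (G j.+1 x)) ->
  forall i, (i <= n)%N -> derive1n i f = G i.
Proof.
move=> fG dG; elim=> [|i IH] // ilt; rewrite derive1nS IH ?(ltnW ilt) //.
by apply/funext => x; apply: is_derive1_derive1; exact: dG.
Qed.

Lemma bounded_L2_vanish (f f1 f2 : R -> R) (K : R) : L2 f ->
  (forall x : R, is_derive x 1 f (f1 x)) -> (forall x : R, is_derive x 1 f1 (f2 x)) ->
  (forall x, `|f x| <= K /\ `|f1 x| <= K) ->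
  (forall x, f1 x ^+ 2 - 2 * f x * f1 x + f x * f2 x = 0) -> forall x, f x = 0.
Proof.
move=> [mf fL2] df df1 fK F0.
have dexp (x : R) : is_derive x 1 (fun y : R => expR (- 2 * y)) (expR (- 2 * x) * - 2).
  have := is_derive1_affine (is_derive_expR (- 2 * x + 0)).
  by under eq_fun do rewrite addr0; rewrite addr0.
have const (k : R -> R) : (forall x : R, is_derive x 1 k 0) -> forall x, k x = k 0.
  by move=> dk x; exact: is_derive_0_is_cst.
(* An integrating factor: the derivative of [k] is [exp(-2 x)] times the expression assumed to
   vanish. *)
pose k x := expR (- 2 * x) * (f x * f1 x).
have kc : forall x, k x = k 0.
  apply: const => x.
  apply: (is_derive1_eq (is_derive1M (dexp x) (is_derive1M (df x) (df1 x)))).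
  rewrite -[RHS](mulr0 (expR (- 2 * x))) -(F0 x); ring.
have K0 : 0 <= K by have [+ _] := fK 0; apply: le_trans.
have k0 : k 0 = 0.
  apply/eqP; rewrite -normr_le0 leNgt; apply/negP => kp.
  (* Chosen so that [|k 0| * exp(2 x) >= |k 0| * (1 + 2 x) > K^2], against the bound on [f * f1]. *)
  pose x := (K * K / `|k 0|) : R.
  have ffx : f x * f1 x = k 0 * expR (2 * x).
    rewrite -(kc x) /k mulrAC -expRD.
    have -> : - 2 * x + 2 * x = 0 by ring.
    by rewrite expR0 mul1r.
  have : `|f x * f1 x| <= K * K by have [h1 h2] := fK x; rewrite normrM ler_pM.
  rewrite ffx normrM (ger0_norm (expR_ge0 _)) leNgt => /negP; apply.
  rewrite -ltr_pdivrMl // [X in X < _](_ : _ = x); last by rewrite /x mulrC.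
  have x0 : 0 <= x by rewrite /x divr_ge0 // mulr_ge0.
  by have := expR_ge1Dx (2 * x); lra.
have ff1 x : f x * f1 x = 0.
  have := kc x; rewrite k0 /k => /eqP; rewrite mulf_eq0 gt_eqF ?expR_gt0 //=.
  by move=> /eqP.
have sq : forall x, f x ^+ 2 = f 0 ^+ 2.
  apply: (const (fun x => f x ^+ 2)) => x.
  apply: (is_derive1_eq (is_derive1X 2 (df x))).
  by rewrite expr1 -mulrA ff1 mulr0.
suff f00 : f 0 ^+ 2 <= 0.
  by move=> x; apply/eqP; rewrite -sqrf_eq0 sq eq_le f00 sqr_ge0.
rewrite leNgt; apply/negP => c0; set c := f 0 ^+ 2 in c0 sq.
pose I := Rintegral mu setT (fun x => f x ^+ 2).
have bnd (n : R) : 0 < n -> n * c <= I.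
  move=> n0.
  have fi : mu.-integrable `[0, n] (EFin \o (fun x => f x ^+ 2)).
    exact: (integrableS measurableT).
  have -> : n * c = Rintegral mu `[0, n] (fun x => f x ^+ 2).
    under eq_Rintegral do rewrite sq.
    rewrite Rintegral_cst //= lebesgue_measure_itv /= lte_fin n0 -EFinB /=.
    by rewrite subr0 mulrC.
  apply: fine_le; [exact: integrable_fin_num|exact: integrable_fin_num|].
  apply: ge0_subset_integral => //; first exact: measurable_int fL2.
  by move=> y _; rewrite lee_fin sqr_ge0.
have I0 : 0 <= I by apply: Rintegral_ge0 => x _; exact: sqr_ge0.
(* An interval of this length would give [I + 1 <= I]. *)
have := bnd ((I + 1) / c); rewrite divr_gt0 ?ltr_wpDl // divfK ?gt_eqF // => /(_ isT).
by rewrite leNgt ltrDl ltr01.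
Qed.

End classical.

(** * The pseudospherical structure *)

Section surface.
Context {R : realType}.
Implicit Types (T : \bar R) (u : R -> R -> R) (E W : R -> nat -> R -> R).
Notation mu := (@lebesgue_measure R).

Lemma dxn_classical T u E W t i x : classical_solution T u E W -> tI T t -> (i <= 3)%N ->
  dxn i u x t = E t i x.
Proof.
move=> cs Tt i3.
have u0 : u ^~ t = E t 0%N by apply/funext => y; exact: (cs_val cs y Tt).
by rewrite /dxn (derive1n_tower u0 (fun j y => cs_dE cs y Tt (j := j)) i3).
Qed.

Lemma dxn_time_classical T u E W t i x : classical_solution T u E W -> tI T t ->
  (i <= 2)%N -> dxn i (fun x t => W t 0%N x) x t = W t i x.
Proof.
move=> cs Tt i2.
have dW := @derive1n_tower R _ (W t) 2 erefl (fun j y => cs_dW cs y Tt (j := j)).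
by rewrite /dxn (dW _ i2).
Qed.

Lemma classical_C31 T u E W : classical_solution T u E W -> C31 T u.
Proof.
move=> cs; exists (fun x t => W t 0%N x); split; [|split; [|split; [|split]]].
- move=> x t Tt /=; apply: quotient_cvg_tderiv => //.
  have h := @cs_quot _ _ _ _ _ cs 0%N t x isT Tt.
  apply: (cvg_trans _ h); apply: near_eq_cvg.
  near=> s; have [Ts _] : tI T s /\ s != t by near: s; exact: withinT.
  by rewrite !(cs_val cs).
- move=> x t i Tt i3.
  have -> : dxn i u ^~ t = E t i.
    by apply/funext => y; rewrite (dxn_classical _ cs Tt (ltnW i3)).
  by have [] := cs_dE cs x Tt i3.
- move=> x t j Tt j2.
  have -> : dxn j (fun x t => W t 0%N x) ^~ t = W t j.
    by apply/funext => y; rewrite (dxn_time_classical _ cs Tt (ltnW j2)).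
  by have [] := cs_dW cs x Tt j2.
- move=> i i3; apply: (strip_continuous (G := fun t => E t i)).
  + by move=> t Tt /=; exact: (cs_cE cs Tt i3).
  + by move=> t eta Tt eta0 /=; exact: (cs_uE cs i3 Tt eta0).
  + by move=> x t Tt; rewrite (dxn_classical _ cs Tt).
- move=> i i2; apply: (strip_continuous (G := fun t => W t i)).
  + by move=> t Tt /=; exact: (cs_cW cs Tt i2).
  + by move=> t eta Tt eta0 /=; exact: (cs_uW cs i2 Tt eta0).
  + by move=> x t Tt; rewrite (dxn_time_classical _ cs Tt).
Unshelve. all: by end_near. Qed.

Lemma F_classical T u E W t x : classical_solution T u E W -> tI T t ->
  F_of u x t = E t 1%N x ^+ 2 - 2 * E t 0%N x * E t 1%N x + E t 0%N x * E t 2%N x.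
Proof.
by move=> cs Tt; rewrite /F_of !(dxn_classical _ cs Tt) // (cs_val cs).
Qed.

(** This is [m_t = F_x + 2 F]: adding [2 F] to [F_x] cancels the terms in [u_x^2] and [u u_xx], and
    what remains is the right side of [cs_eq]. *)
Lemma dx_F_of T u E W t (x : R) : classical_solution T u E W -> tI T t ->
  is_derive x 1 (fun y => F_of u y t) (W t 0%N x - W t 2%N x - 2 * F_of u x t).
Proof.
move=> cs Tt.
have -> : (fun y => F_of u y t) = (fun y => E t 1%N y ^+ 2 -
    2 * (E t 0%N y * E t 1%N y) + E t 0%N y * E t 2%N y).
  by apply/funext => y; rewrite (F_classical _ cs Tt) mulrA.
have d0 := cs_dE cs x Tt (isT : (0 < 3)%N).
have d1 := cs_dE cs x Tt (isT : (1 < 3)%N).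
have d2 := cs_dE cs x Tt (isT : (2 < 3)%N).
apply: (is_derive1_eq (is_derive1D (is_derive1B (is_derive1X 2 d1)
  (is_derive1Z 2 (is_derive1M d0 d1))) (is_derive1M d0 d2))).
by rewrite (cs_eq cs x Tt) (F_classical _ cs Tt) expr1; ring.
Qed.

(** Order 2 is the highest for which [cs_quot] gives a time derivative, just enough for
    [m = u - u_xx]. *)
Lemma dt_m_of T u E W t x : classical_solution T u E W -> 0 < t -> tI T t ->
  is_derive t 1 (fun s => m_of u x s) (W t 0%N x - W t 2%N x).
Proof.
move=> cs t0 Tt.
have dE j : (j < 3)%N -> is_derive t 1 (fun s => E s j x) (W t j x).
  by move=> j3; apply: (quotient_cvg_is_derive t0 Tt); exact: (@cs_quot _ _ _ _ _ cs j t x j3 Tt).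
apply: is_derive_near (is_derive1B (dE 0%N isT) (dE 2%N isT)).
near=> s; have Ts : tI T s by near: s; exact: tI_near.
by rewrite /m_of (dxn_classical _ cs Ts) // (cs_val cs).
Unshelve. all: by end_near. Qed.

(** Stated on a singleton so that it can be used at each point of a region where [F] does not
    vanish. *)
Lemma classical_pss T u E W (mu0 : R) (sg : bool) x t : classical_solution T u E W ->
  0 < t -> tI T t -> F_of u x t != 0 ->
  pss_structure [set (x, t)] (omega1 u) (omega2 mu0 sg u) (omega3 mu0 sg u).
Proof.
move=> cs t0 Tt F0 _ /= ->.
have dF := dx_F_of x cs Tt; have dm := dt_m_of x cs t0 Tt.
set r := Num.sqrt (1 + mu0 ^+ 2).
have r2 : r * r = 1 + mu0 ^+ 2 by rewrite -expr2 sqr_sqrtr // addr_ge0 // sqr_ge0.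
have r0 : r != 0 by rewrite sqrtr_eq0 -ltNge ltr_wpDr // sqr_ge0.
have s2 : sgn R sg * sgn R sg = 1 by rewrite /sgn; case: ifP => _; ring.
have s0 : sgn R sg != 0 by rewrite /sgn; case: ifP => _; rewrite ?oppr_eq0 oner_eq0.
have dF2 := is_derive1Z mu0 dF; have dF3 := is_derive1Z (sgn R sg * r) dF.
have dm2 := is_derive1D (is_derive1Z mu0 dm) (is_derive_cst (sgn R sg * 2 * r) t 1).
have dm3 := is_derive1D (is_derive1Z (sgn R sg * r) dm) (is_derive_cst (2 * mu0) t 1).
split; first by do 2 split;
  [case: dF|case: dm|case: dF2|case: dm2|case: dF3|case: dm3].
rewrite /dform /wedge /= (is_derive1_derive1 dF) (is_derive1_derive1 dm).
rewrite (is_derive1_derive1 dF2) (is_derive1_derive1 dF3).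
rewrite (is_derive1_derive1 dm2) (is_derive1_derive1 dm3).
clear dF dm dF2 dF3 dm2 dm3; rewrite -/r.
(* Polynomial identities remain. Only the first structure equation needs [s^2 = 1] and
   [r^2 = 1 + mu0^2]; the area form is [- 2 s r F]. *)
move: (F_of u x t) (m_of u x t) F0 (W t 0%N x - W t 2%N x) => F m F0 mt.
move: {r} (r : R) (sgn R sg) r2 r0 s2 s0 => r s r2 r0 s2 s0.
split.
- have -> : (s * r * m + 2 * mu0) * (mu0 * F) - s * r * F * (mu0 * m + s * 2 * r) =
    2 * mu0 ^+ 2 * F - 2 * (s * s) * (r * r) * F by ring.
  by rewrite s2 r2; ring.
- by ring.
- by ring.
- have -> : m * (mu0 * F) - F * (mu0 * m + s * 2 * r) = - (2 * s * r * F) by ring.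
  by rewrite oppr_eq0 !mulf_neq0 // pnatr_eq0.
Qed.

(** A positive time is required because the derivatives in [dform] are two-sided. *)
Lemma exists_nondegenerate_point T u E W : classical_solution T u E W -> (0 < T)%E ->
  ~ {ae mu, forall x, u x 0 = 0} ->
  exists x t, [/\ 0 < t, tI T t & F_of u x t != 0].
Proof.
move=> cs T0 u0; apply: contrapT => noF; apply: u0.
have F0 x t : 0 < t -> tI T t -> F_of u x t = 0.
  by move=> t0 Tt; apply/eqP/negPn/negP => nF; apply: noF; exists x, t.
have E0 x t : 0 < t -> tI T t -> E t 0%N x = 0.
  move=> t0 Tt; have [K EK] := cs_bound cs Tt.
  apply: (bounded_L2_vanish (cs_L2 cs Tt) (f1 := E t 1%N) (f2 := E t 2%N) _ _ EK).
  - by move=> y; exact: (@cs_dE _ _ _ _ _ cs t 0%N y).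
  - by move=> y; exact: (@cs_dE _ _ _ _ _ cs t 1%N y).
  - by move=> y; rewrite -(F_classical _ cs Tt) F0.
have T00 : tI T 0 by [].
apply: (@aeW _ _ _ mu) => x; rewrite (cs_val cs) //.
apply/eqP; rewrite -normr_le0; apply/ler_addgt0Pl => eta eta0; rewrite addr0.
(* Vanishing at all positive times passes to time 0 by continuity in time from the right. *)
have [d /= d0 dP] := cs_uE cs (isT : (0 < 4)%N) T00 eta0.
near ((0 : R)^'+) => s.
have s0 : 0 < s by near: s; exact: nbhs_right_gt.
have Ts : tI T s by near: s; exact: tI_right0.
have sd : s < d by near: s; exact: nbhs_right_lt.
have := dP s; rewrite /= sub0r normrN (ger0_norm (ltW s0)) => /(_ sd Ts x).
by rewrite E0 // sub0r normrN.
Unshelve. all: by end_near. Qed.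

Lemma nondegenerate_open T u E W x t : classical_solution T u E W ->
  0 < t -> tI T t -> F_of u x t != 0 ->
  \forall p \near (x, t), [/\ 0 < p.2, tI T p.2 & F_of u p.1 p.2 != 0].
Proof.
move=> cs t0 Tt F0.
have cont i : (i <= 3)%N -> {for (x, t), continuous (fun p : R * R => E p.2 i p.1)}.
  move=> i3.
  have : {within strip T, continuous (fun p : R * R => E p.2 i p.1)}.
    apply: (strip_continuous (G := fun t => E t i) (f := fun x t => E t i x)) => //.
    + by move=> s Ts /=; exact: (cs_cE cs Ts i3).
    + by move=> s eta Ts eta0 /=; exact: (cs_uE cs i3 Ts eta0).
  move=> /subspace_continuousP /(_ (x, t) Tt) h.
  (* Since [t > 0], the strip is a neighbourhood of the point, and continuity within it is ordinary
     continuity. *)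
  have sn : \forall p \near (x, t), strip T p.
    exists (setT, tI T); first by split; [exact: filterT|exact: tI_near].
    by move=> [y s] [].
  apply: cvg_trans h => P; rewrite /fmap /= => nP.
  by apply: filterS2 sn nP => p sp; exact.
pose Fc (p : R * R) := E p.2 1%N p.1 * E p.2 1%N p.1 - 2 * (E p.2 0%N p.1 * E p.2 1%N p.1)
   + E p.2 0%N p.1 * E p.2 2%N p.1.
have FE p : tI T p.2 -> F_of u p.1 p.2 = Fc p.
  by move=> Tp; rewrite (F_classical _ cs Tp) /Fc expr2 mulrA.
have cF : Fc @ (x, t) --> Fc (x, t).
  have c0 := cont 0%N isT; have c1 := cont 1%N isT; have c2 := cont 2%N isT.
  apply: cvgD; last exact: cvgM.
  apply: cvgB; first exact: cvgM.
  by apply: cvgM; [exact: cvg_cst|exact: cvgM].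
have nF : \forall p \near (x, t), Fc p != 0.
  by apply: (cvgr_neq0 (Fc (x, t)) cF); rewrite -FE.
have nT : \forall p \near (x, t), 0 < p.2 /\ tI T p.2.
  exists (setT, [set s | 0 < s /\ tI T s]).
    by split; [exact: filterT|apply: filterI; [exact: lt_nbhsr|exact: tI_near]].
  by move=> [y s] [].
by apply: filterS2 nT nF => p [p0 Tp] Fp; split; rewrite ?FE.
Qed.

End surface.

(** The strip is [strip T]; being a solution time together with [maximal_time] pins [T] down from
    [u0]. Continuity in [x] selects the representative of [u] whose pointwise derivatives enter the
    forms. *)
Theorem theorem2p2 (R : realType) (u0 : R -> R) (T : \bar R) (u : R -> R -> R)
    (mu0 : R) (sg : bool) :
  H 4 u0 ->
  ~ {ae (@lebesgue_measure R), forall x, u0 x = 0} ->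
  is_solution u0 T u ->
  maximal_time u0 T ->
  (forall t, tI T t -> continuous (fun x => u x t)) ->
  C31 T u /\
  exists C : set (R * R),
    [/\ C !=set0, open C, simply_connected C, C `<=` strip T &
        pss_structure C (omega1 u) (omega2 mu0 sg u) (omega3 mu0 sg u)].
Proof.
move=> _ u0_neq0 sol _ cu.
have [E [W cs]] := solution_classical sol cu.
split; first exact: classical_C31 cs.
have [T0 [_ [_ [_ [_ [_ [_ [_ [_ init]]]]]]]]] := sol.
have [|x [t [t0 Tt F0]]] := exists_nondegenerate_point cs T0.
  move=> u00; apply: u0_neq0; move: init u00.
  by apply: ae_lebesgueS2 => x -> ->.
have /nbhs_ballP[r /= r0 rP] := nondegenerate_open cs t0 Tt F0.
(* The region is an open square around a nondegenerate point, convex and hence simply connected. *)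
exists (ball (x, t) r); split.
- by exists (x, t); exact: ballxx.
- exact: ball_open.
- by apply: convex_simply_connected; exact: ball_segment_convex.
- by move=> p /rP[_ Tp _].
- move=> [y s] /rP[/= s0 Ts Fs].
  exact: (classical_pss mu0 sg cs s0 Ts Fs).
Qed.
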